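(* Danceability is bounded above by braid index. That is, for any knot $K$ in $\mathbb{R}^3$, $da(K)\leq b(K)$, where $da(K)$ is the danceability of $K$ and $b(K)$ is the braid index of $K$.
   Context: A knot is a (tame) closed curve in $\mathbb{R}^3$ with no self-intersections; two knots are regarded as the same if one can be deformed into the other by ambient isotopy. A knot diagram of a knot $K$ is a planar projection of a curve equivalent to $K$, with finitely many transverse double points (crossings), no triple points, and with the over- and under-strand recorded at each crossing. An oriented knot diagram is a knot diagram with a chosen direction of travel along the knot. $n$-danceability ($n\ge 2$): an oriented knot diagram is $n$-danceable if there exist $n$ distinct initial points on the diagram such that: (1) one dancer starts at each of the $n$ initial points; (2) each dancer travels in the direction of the orientation and stops on reaching the next initial point, so that the paths of all dancers together traverse the entire diagram with no overlap; (3) the speeds of the dancers can vary and can be chosen so that the simultaneous tracing of the diagram by all $n$ dancers follows the under-first rule at every crossing, i.e. the under-strand of each crossing is passed strictly before the over-strand of that crossing is passed. Precisely: let the diagram be the image of an oriented circle $S^1$ under the projection, and let $p_0,\dots,p_{n-1}\in S^1$ be the initial points in cyclic order along the orientation, chosen so that they do not project to crossings. Dancer $i$ starts at $p_i$ at time $0$ and moves continuously and monotonically (pausing is allowed) along the oriented arc from $p_i$ to $p_{i+1}$ (indices mod $n$), starting simultaneously with the other dancers and using a common clock. For each crossing, the point of $S^1$ on the under-strand must be traversed at a strictly earlier time than the point of $S^1$ on the over-strand. $1$-danceability: a knot diagram is $1$-danceable if an orientation and a single initial point can be chosen so that one dancer, starting at this point and traversing the entire knot once in the direction of the orientation back to the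 starting point, passes through every crossing on the under-strand first. Danceability: for a knot $K$, $da(K)$ is the minimal $n\ge 1$ for which there is an (oriented) diagram of $K$ that is $n$-danceable, the minimum being taken over all diagrams of $K$ and both orientations. Braid index: a braid on $n$ strands is a collection of $n$ disjoint arcs in $\mathbb{R}^3$ connecting $n$ top points at height $1$ to $n$ bottom points at height $0$, all arcs monotone in height. Its closure is the knot or link obtained by joining the top endpoints to the corresponding bottom endpoints by new (standard, crossing-free) arcs. The braid index $b(K)$ of a knot $K$ is the fewest number of strands of a braid whose closure is $K$ (such a braid exists by Alexander's Theorem). *)

(* Defs.v *)
(* MathComp-Analysis, over an arbitrary [R : realType]. *)
From HB Require Import structures.
From mathcomp Require Import all_boot all_order all_algebra all_fingroup.
From mathcomp Require Import all_classical all_reals all_analysis.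

Set Implicit Arguments.
Unset Strict Implicit.
Unset Printing Implicit Defensive.

Import Order.TTheory GRing.Theory Num.Theory.
Import numFieldNormedType.Exports.

Local Open Scope classical_set_scope.
Local Open Scope ring_scope.

(* A point of space is ((x, y), z).  Diagrams are drawn in the xy-plane and
   viewed from z = +oo, so [fst] is the projection and z decides over/under;
   y is the height coordinate of braids. *)
Notation space3 R := (R * R * R)%type.

Section Knots.
Context {R : realType}.
Implicit Types (K L : set (space3 R)) (gamma : R -> space3 R).

Definition pt (x y z : R) : space3 R := ((x, y), z).
Definition xcoord (p : space3 R) : R := p.1.1.
Definition height (p : space3 R) : R := p.1.2.
Definition plane_proj (p : space3 R) : R * R := p.1.
Definition depth (p : space3 R) : R := p.2.

Definition homeomorphism (f : space3 R -> space3 R) : Prop :=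
  continuous f /\
  exists g : space3 R -> space3 R, [/\ continuous g, cancel f g & cancel g f].

Definition ambient_isotopic K L : Prop :=
  exists H : R -> space3 R -> space3 R,
    [/\ {within `[0, 1] `*` setT, continuous (fun p : R * space3 R => H p.1 p.2)},
        forall t : R, t \in `[0, 1] -> homeomorphism (H t),
        H 0 = id
      & H 1 @` K = L].

(* Simple closed curves are parametrized by the circle R/Z, i.e. by 1-periodic
   functions on R; increasing parameters give the orientation. *)
Definition simple_closed_curve gamma : Prop :=
  [/\ continuous gamma, periodic gamma 1 & {in `[0, 1[ &, injective gamma}].

Definition polygonal gamma : Prop :=
  exists2 N : nat, (0 < N)%N &
    forall (i : nat) (u : R), (i < N)%N -> u \in `[0, 1] ->
      gamma ((i%:R + u) / N%:R) =
        (1 - u) *: gamma (i%:R / N%:R) + u *: gamma (i.+1%:R / N%:R).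

(* Tame: ambient isotopic to a simple closed polygon. *)
Definition knot K : Prop :=
  (exists2 gamma, simple_closed_curve gamma & K = range gamma) /\
  (exists gamma, [/\ simple_closed_curve gamma, polygonal gamma
                   & ambient_isotopic K (range gamma)]).

(* The strand at parameter s passes under the strand at parameter t. *)
Definition crossing gamma (s t : R) : Prop :=
  plane_proj (gamma s) = plane_proj (gamma t) /\
  depth (gamma s) < depth (gamma t).

(* Both planar velocities exist and are linearly independent. *)
Definition transverse gamma (s t : R) : Prop :=
  let x := fun u => (plane_proj (gamma u)).1 in
  let y := fun u => (plane_proj (gamma u)).2 in
  [/\ derivable x s 1 /\ derivable y s 1,
      derivable x t 1 /\ derivable y t 1
    & derive1 x s * derive1 y t - derive1 y s * derive1 x t != 0].

(* [gamma] presents an oriented diagram of K; the last clause excludes triple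
   points.  Both orientations of a diagram occur, as [gamma] and as its reversal
   [fun t => gamma (- t)]. *)
Definition diagram_of K gamma : Prop :=
  [/\ simple_closed_curve gamma,
      ambient_isotopic K (range gamma),
      finite_set [set st : R * R |
        [/\ st.1 \in `[0, 1[, st.2 \in `[0, 1[ & crossing gamma st.1 st.2]],
      (forall s t, crossing gamma s t -> transverse gamma s t)
    & forall (r s t : R), r \in `[0, 1[ -> s \in `[0, 1[ -> t \in `[0, 1[ ->
        plane_proj (gamma r) = plane_proj (gamma s) ->
        plane_proj (gamma s) = plane_proj (gamma t) ->
        [\/ r = s, s = t | r = t]].

Definition one_danceable gamma : Prop :=
  exists p : R, forall s t : R, s \in `[p, p + 1[ -> t \in `[p, p + 1[ ->
    crossing gamma s t -> s < t.

(* p 0 < ... < p n = p 0 + 1 lifts to R the cyclically ordered initial points;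
   d i a is the lifted position of dancer i at time a in [0, T].  A dancer who
   pauses at a point visits it at several times, and the under-first rule then
   holds for all of them. *)
Definition many_danceable (n : nat) gamma : Prop :=
  exists (p : nat -> R) (T : R) (d : nat -> R -> R),
    [/\ p n = p 0%N + 1 /\
        (forall i, (i < n)%N -> p i < p i.+1),
        (forall i t, (i < n)%N ->
          ~ crossing gamma (p i) t /\ ~ crossing gamma t (p i)),
        0 < T,
        (forall i, (i < n)%N ->
          [/\ {within `[0, T], continuous (d i)},
              {in `[0, T] &, {homo d i : a b / a <= b}},
              d i 0 = p i
            & d i T = p i.+1])
      & forall (i j : nat) (a b : R), (i < n)%N -> (j < n)%N ->
          a \in `[0, T] -> b \in `[0, T] ->
          crossing gamma (d i a) (d j b) -> a < b].

Definition danceable (n : nat) gamma : Prop :=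
  (n = 1%N /\ one_danceable gamma) \/ ((2 <= n)%N /\ many_danceable n gamma).

(* The least element of a set of naturals, +oo if the set is empty. *)
Definition least (A : set nat) : \bar R := ereal_inf [set n%:R%:E | n in A].

Definition danceability K : \bar R :=
  least [set n | exists2 gamma, diagram_of K gamma & danceable n gamma].

(* Strand i descends from the i-th top point (i+1, 1, 0) to a bottom point
   (j+1, 0, 0).  The braid is normalized to lie in the half-space x > 0, the
   closing arcs going around it through x < 0. *)
Definition braid (n : nat) (beta : 'I_n -> R -> space3 R) : Prop :=
  [/\ forall i, {within `[0, 1], continuous (beta i)},
      forall i, {in `[0, 1] &, forall s t, s < t ->
        height (beta i t) < height (beta i s)},
      (forall i, beta i 0 = pt i.+1%:R 1 0) /\
      (exists sigma : 'S_n, forall i, beta i 1 = pt (sigma i).+1%:R 0 0),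
      forall i (t : R), t \in `[0, 1] -> 0 < xcoord (beta i t)
    & trivIset setT (fun i => beta i @` `[0, 1])].

Definition segment (a b : space3 R) : set (space3 R) :=
  [set (1 - u) *: a + u *: b | u in `[0, 1]].

Fixpoint polyline (a : space3 R) (s : seq (space3 R)) : set (space3 R) :=
  if s is b :: s' then segment a b `|` polyline b s' else [set a].

(* The i-th top and bottom points are joined in the plane z = 0 along the
   rectangle [-c, c] x [-c, 1 + c] with c = i + 1; these rectangles are nested,
   so the closing arcs are disjoint and have no crossings. *)
Definition closing_arc (i : nat) : set (space3 R) :=
  let c := i.+1%:R in
  polyline (pt c 1 0)
    [:: pt c (1 + c) 0; pt (- c) (1 + c) 0; pt (- c) (- c) 0; pt c (- c) 0;
        pt c 0 0].

Definition closure_of (n : nat) (beta : 'I_n -> R -> space3 R) : set (space3 R) :=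
  \bigcup_(i in setT) (beta i @` `[0, 1] `|` closing_arc i).

Definition braid_index K : \bar R :=
  least [set n | exists2 beta : 'I_n -> R -> space3 R,
                   braid beta & ambient_isotopic K (closure_of beta)].

End Knots.

(* Main.v *)
(* Cut the braid into finitely many thin slabs and replace it, by a small
   isotopy that preserves heights, by a piecewise linear braid in which only
   one strand moves in each slab, all others being vertical in the diagram; then
   the diagram has finitely many crossings, all transverse, and no triple point.
   As K is connected, the strands and the closing arcs form one closed curve,
   and each of the n dancers follows one strand and the closing arc after it.
   The two strands at a crossing are at the same height, so it suffices to
   synchronize the dancers by the function 1 - height + e * depth, which is
   increasing along every strand once e is small against the slopes: the lower
   strand of a crossing is then passed strictly before the upper one. *)
Require Import Defs.
From HB Require Import structures.
From mathcomp Require Import all_boot all_order all_algebra all_fingroup.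
From mathcomp Require Import all_classical all_reals all_analysis.
From mathcomp Require Import ring lra zify.

Set Implicit Arguments.
Unset Strict Implicit.
Unset Printing Implicit Defensive.

Import Order.TTheory GRing.Theory Num.Theory.
Import numFieldNormedType.Exports.

Local Open Scope classical_set_scope.
Local Open Scope ring_scope.

(** * Level-preserving isotopies *)

(** All isotopies come from one device: a displacement inside horizontal planes that is
    1/2-Lipschitz in each plane is a homeomorphism, and so are its multiples by t in [0, 1]. Hence
    no isotopy extension theorem is used, only a positive distance between strands, which
    compactness gives. The obstacle is general position. The given strands are merely continuous and
    may project onto each other along whole intervals. Besides moving one at a time, the new strands
    must have distinct abscissas at every level where a slab ends. This is arranged arithmetically:
    after scaling by an integer [B], the abscissas have prescribed fractional parts, nonzero and
    pairwise different at interior vertices, and 0 at the end points, whose abscissas are fixed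
    integers. The positions of the dancers come from inverting the clock, which is again the
    identity plus a 1/2-Lipschitz function. *)

Section Contraction.
Context {R : realType}.

Lemma lip_continuous (E F : normedModType R) (k : R) (f : E -> F) :
  (forall x y, `|f x - f y| <= k * `|x - y|) -> continuous f.
Proof.
move=> f_lip x; apply/cvgrPdist_le => e e0.
have k0 : 0 < `|k| + 1 by rewrite ltr_wpDl.
near=> t; apply: (le_trans (f_lip _ _)).
apply: (@le_trans _ _ ((`|k| + 1) * `|x - t|)).
  by rewrite ler_wpM2r// (le_trans (ler_norm k))// lerDl.
rewrite -ler_pdivlMl//; near: t.
by apply: cvgr_dist_le; [exact: cvg_id|rewrite mulr_gt0// invr_gt0].
Unshelve. all: by end_near. Qed.

Lemma contraction_surj (g : R -> R) :
  (forall x y, `|g x - g y| <= 2^-1 * `|x - y|) ->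
  forall y, exists x, x + g x = y.
Proof.
move=> g_lip y.
have gc : continuous g by exact: (@lip_continuous R^o R^o _ _ g_lip).
have fc : continuous (fun x => x + g x) by move=> x; apply: cvgD => //; exact: gc.
(* On [- r, r] the map [g] stays within r / 2 of [g 0], so [x + g x] is beyond [y] on either side at
   the two ends. *)
have [r rE] : exists r, r = 2 * (`|y - g 0| + 1) by eexists.
have r0 : 0 < r by rewrite rE; have := normr_ge0 (y - g 0); lra.

have [| | |c _ <-] := @IVT R (fun x => x + g x) (- r) r y; last by exists c.

- by lra.
- exact/continuous_subspaceT.
have := g_lip r 0; have := g_lip (- r) 0.
rewrite !subr0 normrN (gtr0_norm r0) !ler_norml => /andP[? ?] /andP[? ?].
have := ler_norm (y - g 0); have := ler_norm (- (y - g 0)); rewrite normrN => ? ?.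
by rewrite ge_min le_max; apply/andP; split; apply/orP; [left|right];
  lra.
Qed.

(** The two coordinates are solved one after the other. For the max norm, the solution [xi z] of the
    first equation is 1-Lipschitz in [z]; substituting it leaves a second equation to which the
    one-dimensional case applies. *)
Lemma contraction2_surj (g : R * R -> R * R) :
  (forall p q, `|g p - g q| <= 2^-1 * `|p - q|) ->
  forall q, exists p, p + g p = q.
Proof.
move=> g_lip [x0 z0].
have g1_lip z x y : `|(g (x, z)).1 - (g (y, z)).1| <= 2^-1 * `|x - y|.
  have := g_lip (x, z) (y, z); rewrite !prod_normE/= subrr normr0.
  rewrite (max_l (normr_ge0 _)); apply: le_trans; rewrite le_max lexx//.
have /choice[xi xiE] : forall z, exists x, x + (g (x, z)).1 = x0.
  by move=> z; exact: contraction_surj.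
have xi_lip z z' : `|xi z - xi z'| <= `|z - z'|.
  have := g_lip (xi z, z) (xi z', z'); rewrite !prod_normE/= ge_max => /andP[+ _].
  have -> : (g (xi z, z)).1 - (g (xi z', z')).1 = - (xi z - xi z').
    by have := xiE z; have := xiE z'; lra.
  rewrite normrN; case: (leP `|xi z - xi z'| `|z - z'|) => // ?.
  by have := normr_ge0 (z - z'); lra.
have [z zE] : exists z, z + (g (xi z, z)).2 = z0.
  apply: contraction_surj => z z'.
  have := g_lip (xi z, z) (xi z', z'); rewrite !prod_normE/= ge_max => /andP[_].
  by rewrite (max_r (xi_lip _ _)).
by exists (xi z, z); rewrite -(xiE z) -zE.
Qed.

End Contraction.

(** * Homeomorphisms that move points inside horizontal planes *)

Section Displacement.
Context {R : realType}.
Implicit Types (p : space3 R) (q : R * R) (K L : set (space3 R)).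

(** Position inside a horizontal plane. This is not the projection of the diagram: [plane_proj]
    drops the depth, [planar] drops the height. *)
Definition planar p : R * R := (p.1.1, p.2).
Definition lift q (y : R) : space3 R := pt q.1 y q.2.

Lemma planar_lift q y : planar (lift q y) = q. Proof. by case: q. Qed.
Lemma height_lift q y : height (lift q y) = y. Proof. by []. Qed.
Lemma lift_planar p : lift (planar p) (height p) = p.
Proof. by case: p => -[]. Qed.

Lemma continuous_fst (U V : topologicalType) : continuous (@fst U V).
Proof. by case=> a b; exact: cvg_fst. Qed.

Lemma continuous_snd (U V : topologicalType) : continuous (@snd U V).
Proof. by case=> a b; exact: cvg_snd. Qed.

Lemma cvg_pair_nbhs (T : Type) (U V : topologicalType) (F : set_system T)
    {FF : Filter F} (f : T -> U) (g : T -> V) (a : U) (b : V) :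
  f x @[x --> F] --> a -> g x @[x --> F] --> b ->
  (f x, g x) @[x --> F] --> (a, b).
Proof. by move=> fa gb; exact: (cvg_pair (G := nbhs a) (H := nbhs b) fa gb). Qed.

Lemma cvg_lift (T : Type) (F : set_system T) {FF : Filter F}
    (f : T -> R * R) (g : T -> R) q y :
  f x @[x --> F] --> q -> g x @[x --> F] --> y ->
  lift (f x) (g x) @[x --> F] --> lift q y.
Proof.
move=> fq gy; rewrite /lift /pt; apply: cvg_pair_nbhs => /=.
  apply: cvg_pair_nbhs => //=.
  exact: (@continuous_cvg _ _ _ _ _ f fst q (@continuous_fst _ _ q)).
exact: (@continuous_cvg _ _ _ _ _ f snd q (@continuous_snd _ _ q)).
Qed.

Lemma continuous_planar : continuous planar.
Proof.
move=> p; apply: cvg_pair_nbhs => /=; last exact: continuous_snd.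
exact: (@continuous_comp _ _ _ fst fst p (@continuous_fst _ _ _)
         (@continuous_fst _ _ _)).
Qed.

Lemma continuous_height : continuous (@height R).
Proof.
move=> p; exact: (@continuous_comp _ _ _ fst snd p (@continuous_fst _ _ _)
                   (@continuous_snd _ _ _)).
Qed.

Definition displace (G : space3 R -> R * R) p := lift (planar p + G p) (height p).

Lemma displace_homeomorphism (G : space3 R -> R * R) :
  continuous G ->
  (forall q q' y, `|G (lift q y) - G (lift q' y)| <= 2^-1 * `|q - q'|) ->
  homeomorphism (displace G).
Proof.
move=> Gc G_lip; split.
  move=> p; apply: cvg_lift; last exact: continuous_height.
  by apply: cvgD; [exact: continuous_planar|exact: Gc].
have /choice[Q QE] : forall p, exists q, q + G (lift q (height p)) = planar p.
  by move=> p; exact: (contraction2_surj (fun q q' => G_lip q q' (height p))).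
have expand q q' y :
    `|q - q'| <= 2 * `|(q + G (lift q y)) - (q' + G (lift q' y))|.
  have -> : (q + G (lift q y)) - (q' + G (lift q' y)) =
      (q - q') + (G (lift q y) - G (lift q' y)) by rewrite opprD addrACA.
  have := ler_normB ((q - q') + (G (lift q y) - G (lift q' y)))
                    (G (lift q y) - G (lift q' y)).
  by rewrite addrK; have := G_lip q q' y; lra.
exists (fun p => lift (Q p) (height p)); split.
- move=> p0; apply: cvg_lift; last exact: continuous_height.
  apply/cvgrPdist_le => e e0.
  (* The error of the fixed point [Q p0] in the equation at [p]: it is continuous, vanishes at [p0],
     and by [expand] bounds half the distance from [Q p0] to [Q p]. *)
  pose h p := Q p0 + G (lift (Q p0) (height p)) - planar p.
  have hc : h p @[p --> p0] --> h p0.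
    apply: cvgB; last exact: continuous_planar.
    apply: cvgD; first exact: cvg_cst.
    apply: (@continuous_cvg _ _ _ _ _ _ G _ (Gc _)).
    by apply: cvg_lift; [exact: cvg_cst|exact: continuous_height].
  have h0 : h p0 = 0 by rewrite /h QE subrr.
  have e2 : 0 < e / 2 by rewrite divr_gt0.
  move/cvgrPdist_le : hc => /(_ _ e2); rewrite h0; apply: filterS => p.
  rewrite sub0r normrN /h -QE => hp.
  by apply: (le_trans (expand _ _ (height p))); lra.
- move=> p; have hp : height (displace G p) = height p by [].
  suff -> : Q (displace G p) = planar p by rewrite hp lift_planar.
  apply/eqP; rewrite -subr_eq0 -normr_eq0 eq_le normr_ge0 andbT.
  apply: (le_trans (expand _ _ (height p))).
  by rewrite -{1}hp QE lift_planar /displace planar_lift subrr normr0 mulr0.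
- by move=> p; rewrite /displace planar_lift height_lift QE lift_planar.
Qed.

Lemma displace_isotopic (G : space3 R -> R * R) K :
  continuous G ->
  (forall q q' y, `|G (lift q y) - G (lift q' y)| <= 2^-1 * `|q - q'|) ->
  ambient_isotopic K (displace G @` K).
Proof.
move=> Gc G_lip; exists (fun t => displace (fun p => t *: G p)); split.
- suff c : continuous (fun x : R * space3 R => displace (fun p => x.1 *: G p) x.2).
    exact: continuous_subspaceT c.
  move=> x; apply: (@cvg_lift _ (nbhs x)); last first.
    exact: (@continuous_cvg _ _ _ _ _ snd (@height R) x.2
             (@continuous_height x.2) (@continuous_snd _ _ x)).
  apply: cvgD.
    exact: (@continuous_cvg _ _ _ _ _ snd planar x.2
             (@continuous_planar x.2) (@continuous_snd _ _ x)).
  apply: cvgZ; first exact: continuous_fst.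
  exact: (@continuous_cvg _ _ _ _ _ snd G x.2 (Gc x.2) (@continuous_snd _ _ x)).
- move=> t; rewrite in_itv/= => /andP[t0 t1]; apply: displace_homeomorphism.
    by move=> p; apply: cvgZ; [exact: cvg_cst|exact: Gc].
  move=> q q' y; rewrite -scalerBr normrZ ger0_norm//.
  apply: le_trans (G_lip q q' y); rewrite -[leRHS]mul1r.
  by rewrite ler_wpM2r.
- by apply/funext => p; rewrite /displace scale0r addr0 lift_planar.
- by congr (_ @` _); apply/funext => p; rewrite /displace scale1r.
Qed.

(** The isotopies are composed at each time rather than run one after the other, so nothing has to
    be glued at a midpoint. *)
Lemma ambient_isotopic_trans K L M :
  ambient_isotopic K L -> ambient_isotopic L M -> ambient_isotopic K M.
Proof.
move=> [H [Hc Hh H0 HK]] [I [Ic Ih I0 IL]].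
exists (fun t => I t \o H t); split.
- move: Hc Ic => /subspace_continuousP Hc /subspace_continuousP Ic.
  apply/subspace_continuousP => x xA; set A := `[0, 1] `*` setT in Hc Ic xA *.
  have yA : A (x.1, H x.1 x.2) by case: xA.
  have c1 : (y.1, H y.1 y.2) @[y --> within A (nbhs x)] --> (x.1, H x.1 x.2).
    apply: (@cvg_pair_nbhs _ _ _ (within A (nbhs x))); last by move: (Hc x xA); exact: id.
    exact: (cvg_within_filter A (@continuous_fst _ _ x)).
  move=> B /(Ic _ yA)/c1 BH; apply: (@filterS _ (nbhs x) _ _ _ _ BH) => y /= yB yA'.
  by apply: yB => //; case: yA'.
- move=> t t01; have [Hcont [h [hc hK Kh]]] := Hh t t01.
  have [Icont [k [kc kK Kk]]] := Ih t t01; split.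
    by move=> p; apply: continuous_comp; [exact: Hcont|exact: Icont].
  exists (h \o k); split.
  + by move=> p; apply: continuous_comp; [exact: kc|exact: hc].
  + exact: can_comp.
  + exact: can_comp.
- by rewrite H0 I0.
- by rewrite -IL -HK image_comp.
Qed.

End Displacement.

(** * Carrying disjoint strands to nearby ones *)

Section MovePoints.
Context {R : realType}.
Implicit Types (p : space3 R) (K L : set (space3 R)).

Definition bump (r s : R) : R := Num.max 0 (1 - s / r).

Lemma bump_lip r s s' : 0 < r -> `|bump r s - bump r s'| <= r^-1 * `|s - s'|.
Proof.
move=> r0; have ri0 : 0 < r^-1 by rewrite invr_gt0.
rewrite -[r^-1 in leRHS]gtr0_norm// -normrM mulrBr ![r^-1 * _]mulrC /bump.
move: (s / r) (s' / r) => x y; have := ler_norm (x - y).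
have := ler_norm (- (x - y)); rewrite normrN => ? ?; have := normr_ge0 (x - y) => ?.
by rewrite ler_norml; case: (leP 0 (1 - x)); case: (leP 0 (1 - y)) => *;
  apply/andP; split; lra.
Qed.

Lemma continuous_bump r : 0 < r -> continuous (bump r).
Proof.
by move=> r0; apply: (@lip_continuous _ R^o R^o r^-1) => x y; exact: bump_lip.
Qed.

Lemma bump0 r : bump r 0 = 1.
Proof. by rewrite /bump mul0r subr0 max_r. Qed.

Lemma bump_eq0 r s : 0 < r -> r <= s -> bump r s = 0.
Proof. by move=> r0 rs; rewrite /bump max_l// subr_le0 ler_pdivlMr// mul1r. Qed.

(** The field is a sum of tents of radius [r] around the strands [q i], each carrying [b i - q i]. A
    tent is 1/r-Lipschitz and a displacement is at most r / (2n), so the [n] terms together are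
    1/2-Lipschitz. By the separation [r], only the tent of strand [i] acts on strand [i]. The
    argument is [1 - height] because strands are parametrized downwards. The last clause serves to
    fix the closing arcs. *)
Lemma move_points n (q b : 'I_n -> R -> R * R) (r : R) :
  (0 < n)%N -> 0 < r ->
  (forall i, continuous (q i)) -> (forall i, continuous (b i)) ->
  (forall i j s, i != j -> r <= `|q i s - q j s|) ->
  (forall i s, `|b i s - q i s| <= r / (2 * n%:R)) ->
  exists F : space3 R -> space3 R,
    [/\ forall K, ambient_isotopic K (F @` K),
        forall i s, F (lift (q i s) (1 - s)) = lift (b i s) (1 - s)
      & forall p, (forall i, r <= `|planar p - q i (1 - height p)| \/
                             b i (1 - height p) = q i (1 - height p)) ->
          F p = p].
Proof.
move=> n0 r0 qc bc sep close.
have n0' : 0 < n%:R :> R by rewrite ltr0n.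
pose w i p := `|planar p - q i (1 - height p)|.
pose G p := \sum_i bump r (w i p) *: (b i (1 - height p) - q i (1 - height p)).
have c1h : continuous (fun p : space3 R => 1 - height p).
  by move=> p; apply: cvgB; [exact: cvg_cst|exact: continuous_height].
have Gc : continuous G.
  move=> p; apply: (cvg_big (@add_continuous _)) => i _.
  have ch (f : R -> R * R) : continuous f ->
      f (1 - height p') @[p' --> p] --> f (1 - height p).
    by move=> fc; exact: (@continuous_cvg _ _ _ _ _ _ f _ (fc _) (c1h p)).
  have wc : w i p' @[p' --> p] --> w i p.
    by apply: cvg_norm; apply: cvgB; [exact: continuous_planar|exact: ch].
  have bwc : bump r (w i p') @[p' --> p] --> bump r (w i p).
    exact: (@continuous_cvg _ _ _ _ _ (w i) (bump r) _ (@continuous_bump r r0 (w i p)) wc).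
  exact: cvgZ bwc (cvgB (ch _ (bc i)) (ch _ (qc i))).
have G_lip x x' y : `|G (lift x y) - G (lift x' y)| <= 2^-1 * `|x - x'|.
  rewrite /G -sumrB; apply: (le_trans (ler_norm_sum _ _ _)).
  apply: (@le_trans _ _ (\sum_(i < n) (r^-1 * `|x - x'|) * (r / (2 * n%:R)))).
    apply: ler_sum => i _; rewrite !height_lift -scalerBl normrZ.
    apply: ler_pM => //; apply: (le_trans (bump_lip _ _ r0)).
    rewrite ler_pM2l ?invr_gt0// /w !planar_lift !height_lift.
    by apply: (le_trans (ler_dist_dist _ _)); rewrite opprB addrA subrK.
  rewrite sumr_const card_ord -mulr_natl.
  have D0 := normr_ge0 (x - x'); move: `|x - x'| D0 => D _.
  have rn0 : r != 0 by rewrite gt_eqF.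
  have nn0 : n%:R != 0 :> R by rewrite gt_eqF.
  rewrite le_eqVlt; apply/orP; left; apply/eqP.
  by field; rewrite nn0 rn0.
exists (displace G); split; first by move=> K; exact: displace_isotopic.
- move=> i s; rewrite /displace planar_lift height_lift; congr lift.
  rewrite /G (bigD1 i)//= big1 ?addr0 => [|j ji].
    by rewrite /w planar_lift height_lift subKr subrr normr0 bump0 scale1r addrC subrK.
  by rewrite /w planar_lift height_lift subKr bump_eq0 ?scale0r// sep// eq_sym.
- move=> p pE; rewrite /displace /G big1 ?addr0 ?lift_planar// => i _.
  by case: (pE i) => [far|->]; [rewrite bump_eq0// scale0r|rewrite subrr scaler0].
Qed.

End MovePoints.

(** * Piecewise linear approximation of braids *)

Section Paths.
Context {R : realType} {E : normedModType R}.
Implicit Types (f : nat -> R -> E) (V : nat -> E).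

Definition clamp (x : R) : R := Num.max 0 (Num.min 1 x).

Lemma clamp_ge0 x : 0 <= clamp x. Proof. by rewrite le_max lexx. Qed.
Lemma clamp_le1 x : clamp x <= 1. Proof. by rewrite ge_max ler01 ge_min lexx. Qed.
Lemma clamp_le0 x : x <= 0 -> clamp x = 0.
Proof. by move=> x0; rewrite /clamp max_l// ge_min x0 orbT. Qed.
Lemma clamp_ge1 x : 1 <= x -> clamp x = 1.
Proof. by move=> x1; rewrite /clamp min_l// max_r. Qed.
Lemma clamp_id x : 0 <= x <= 1 -> clamp x = x.
Proof. by move=> /andP[x0 x1]; rewrite /clamp min_r// max_r. Qed.
Lemma clampK x : clamp (clamp x) = clamp x.
Proof. by rewrite clamp_id// clamp_ge0 clamp_le1. Qed.

Lemma clamp_lip x y : `|clamp x - clamp y| <= `|x - y|.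
Proof.
wlog xy : x y / x <= y => [H|].
  by have [/H//|/ltW/H] := leP x y; rewrite distrC [leRHS]distrC.
have mono : clamp x <= clamp y.
  by rewrite /clamp ge_max !le_max lexx/= le_min !ge_min lexx xy !orbT.
rewrite distrC [leRHS]distrC !ger0_norm ?subr_ge0//.
have [y0|y0] := leP y 0; first by rewrite !clamp_le0 ?subrr ?subr_ge0// (le_trans xy).
have [x1|x1] := leP 1 x; first by rewrite !clamp_ge1 ?subrr ?subr_ge0// (le_trans x1).
have cy : clamp y <= y by rewrite /clamp ge_max (ltW y0) ge_min lexx orbT.
have cx : x <= clamp x by rewrite /clamp le_max le_min lexx (ltW x1) orbT.
lra.
Qed.

Lemma continuous_clamp : continuous clamp.
Proof.
by apply: (@lip_continuous _ R^o R^o 1) => x y; rewrite mul1r; exact: clamp_lip.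
Qed.

Definition clamped (g : R -> E) := forall u, g (clamp u) = g u.

(* For maps [f l] that are constant outside [0, 1] and match at their ends, the
   sum telescopes to [f l u] at [s = l + u]. *)
Definition concat f n s := f 0%N 0 + \sum_(l < n) (f l (s - l%:R) - f l 0).

Lemma concat_ge f n s : (forall l, clamped (f l)) -> n%:R <= s ->
  concat f n s = concat f n n%:R.
Proof.
move=> fc ns; congr (_ + _); apply: eq_bigr => l _; congr (_ - _).
have ln : l.+1%:R <= n%:R :> R by rewrite ler_nat.
rewrite -natr1 in ln.
by rewrite -[LHS]fc -[RHS]fc !clamp_ge1//; lra.
Qed.

Lemma concatE f n l u :
  (forall l, clamped (f l)) -> (forall l, (l.+1 < n)%N -> f l 1 = f l.+1 0) ->
  (l < n)%N -> 0 <= u <= 1 -> concat f n (l%:R + u) = f l u.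
Proof.
move=> fc; elim: n l u => // n IH l u chain ln u01; have /andP[u0 u1] := u01.
have {}IH l' u' := IH l' u' (fun k kn => chain k (ltnW kn)).
rewrite /concat big_ord_recr/= addrA -/(concat f n _).
move: ln; rewrite ltnS leq_eqVlt => /orP[/eqP ->|ln]; last first.
  have : l.+1%:R <= n%:R :> R by rewrite ler_nat.
  rewrite -natr1 => ln'.
  by rewrite IH// -[f n (_ - _)]fc clamp_le0 ?subrr ?addr0//; lra.
rewrite [_ + u]addrC addrK; case: n => [|n] in IH chain *.
  by rewrite /concat big_ord0 addr0 addrC subrK.
(* The first [n.+1] pieces are past their ends and rest at [f n 1], which is the start of the last
   piece. *)
rewrite concat_ge// ?lerDr// -natr1 IH ?lexx ?ler01// chain//.
by rewrite addrC subrK.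
Qed.

Lemma concat_clamped f n : (forall l, clamped (f l)) ->
  clamped (fun s => concat f n (n%:R * s)).
Proof.
move=> fc s; have [s0|s0] := leP s 0; last have [s1|s1] := leP 1 s.
- rewrite clamp_le0// mulr0; congr (_ + _); apply: eq_bigr => l _; congr (_ - _).
  have l0 : 0 <= l%:R :> R by [].
  have ns0 : n%:R * s <= 0 by rewrite mulr_ge0_le0.
  by rewrite -[LHS]fc -[RHS]fc !clamp_le0//; lra.
- by rewrite clamp_ge1// mulr1 [RHS]concat_ge// ler_peMr.
- by rewrite clamp_id// !ltW.
Qed.

(** Continuity holds term by term, without any pasting at the junctions: this is the gain of
    defining [concat] as a sum. *)
Lemma continuous_concat f n : (forall l, continuous (f l)) -> continuous (concat f n).
Proof.
move=> fc s; apply: cvgD; first exact: cvg_cst.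
apply: (cvg_big (@add_continuous _)) => l _; apply: cvgB; last exact: cvg_cst.
have c : x - l%:R @[x --> s] --> s - l%:R by apply: cvgB; [exact: cvg_id|exact: cvg_cst].
exact: (@continuous_cvg _ _ _ _ _ _ (f l) _ (@fc l (s - l%:R)) c).
Qed.

Definition pl_step V m (u : R) := V m + clamp u *: (V m.+1 - V m).

Lemma pl_step_clamped V m : clamped (pl_step V m).
Proof. by move=> u; rewrite /pl_step clampK. Qed.

Definition pl V n s := concat (pl_step V) n s.

Lemma plE V n m u : (m < n)%N -> 0 <= u <= 1 ->
  pl V n (m%:R + u) = V m + u *: (V m.+1 - V m).
Proof.
move=> mn u01; rewrite -[in RHS](clamp_id u01); apply: concatE => //.
  by move=> l; exact: pl_step_clamped.
by move=> l _; rewrite /pl_step clamp_ge1// clamp_le0// scale1r scale0r addr0 addrC subrK.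
Qed.

Lemma pl_lip V n :
  exists L, forall s t, `|pl V n s - pl V n t| <= L * `|s - t|.
Proof.
exists (\sum_(m < n) `|V m.+1 - V m|) => s t.
rewrite /pl /concat opprD addrACA subrr add0r -sumrB mulr_suml.
apply: (le_trans (ler_norm_sum _ _ _)); apply: ler_sum => m _.
rewrite /pl_step opprB addrA subrK opprD addrACA subrr add0r -scalerBl normrZ mulrC.
apply: ler_wpM2l => //; apply: (le_trans (clamp_lip _ _)).
by rewrite opprB addrA subrK.
Qed.

Lemma step_of n (s : R) : 0 <= s < n%:R ->
  exists m u, [/\ (m < n)%N, 0 <= u < 1 & s = m%:R + u].
Proof.
move=> /andP[s0 sn]; have /andP[ts st] := truncn_itv s0.
exists (Num.truncn s), (s - (Num.truncn s)%:R); split.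
- by rewrite -(ltr_nat R); exact: le_lt_trans sn.
- by rewrite subr_ge0 ts/= ltrBlDr addrC natr1.
- by rewrite addrC subrK.
Qed.

End Paths.

(* Keeps [done] from comparing curves by unfolding them. *)
Opaque concat.

(** * Uniform choices and fractional parts *)

Section Preliminaries.
Context {R : realType}.

Lemma step_of_closed n (s : R) : (0 < n)%N -> 0 <= s <= n%:R ->
  exists m u, [/\ (m < n)%N, 0 <= u <= 1 & s = m%:R + u].
Proof.
move=> n0 /andP[s0]; rewrite le_eqVlt => /orP[/eqP ->|sn].
  by exists n.-1, 1; rewrite ltn_predL n0 ler01 lexx natr1 prednK.
have [|m [u [mn /andP[u0 u1] sE]]] := @step_of R n s; first by rewrite s0.
by exists m, u; rewrite mn u0 ltW.
Qed.

(** Serves to choose one small constant for all strands, or all pairs of strands, at once; the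
    minimum starts at 1, so that [I] may be empty. *)
Lemma finite_pos (I : finType) (P : I -> R -> Prop) :
  (forall i d d', 0 < d' <= d -> P i d -> P i d') ->
  (forall i, exists2 d, 0 < d & P i d) -> exists2 d, 0 < d & forall i, P i d.
Proof.
move=> mono ex; have /choice[d dP] : forall i, exists d, 0 < d /\ P i d.
  by move=> i; have [d ? ?] := ex i; exists d.
have m0 : 0 < \big[Num.min/1]_i d i.
  apply: (big_ind (fun x => 0 < x)) => // [x y|i _]; last by case: (dP i).
  by rewrite lt_min => -> ->.
exists (\big[Num.min/1]_i d i) => // i; have [_ Pi] := dP i.
by apply: mono Pi; rewrite m0/=; exact: bigmin_le.
Qed.

Lemma segment_unif_continuous (E : normedModType R) (f : R -> E) (e : R) :
  continuous f -> 0 < e ->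
  exists2 d, 0 < d & forall s t, 0 <= s <= 1 -> `|s - t| <= d -> `|f s - f t| <= e.
Proof.
move=> fc e0.
have e2 : 0 < e / 2 by rewrite divr_gt0.
pose P (d s : R) := forall t, `|s - t| <= d -> `|f s - f t| <= e.
have ncov := (compact_near_coveringP _).1 (@segment_compact R 0 1).
have : \forall d \near 0^'+, `[0, 1]%classic `<=` P d.
  apply: ncov => x _.
  have /cvgrPdist_le/(_ _ e2)/nbhs_ballP[r /= r0 rP] := fc x.
  have r2 : 0 < r / 2 by rewrite divr_gt0.
  exists (ball x (r / 2), [set d | d < r / 2]); first split => /=.
  - exact: nbhsx_ballx.
  - exact: nbhs_right_lt.
  move=> [s d] [/= xs dr] t st.
  have xs' : ball x r s by apply: le_ball xs; lra.
  have xt : ball x r t.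
    by move: xs; rewrite /ball/= => xs; have := ler_distD s x t; lra.
  have := rP _ xs'; have := rP _ xt; have := ler_distD (f x) (f s) (f t).
  by rewrite [`|f s - f x|]distrC => *; lra.
move=> nP; near (0 : R)^'+ => d; exists d => // s t s01.
have dP : `[0, 1]%classic `<=` P d by near: d.
by apply: dP; rewrite /= in_itv.
Unshelve. all: by end_near. Qed.

Lemma int_frac_inj (z z' : int) (f f' : R) : 0 <= f < 1 -> 0 <= f' < 1 ->
  z%:~R + f = z'%:~R + f' -> f = f'.
Proof.
move=> /andP[f0 f1] /andP[f0' f1'] zf.
suff zz : z = z' by move: zf; rewrite zz => /addrI.
have E (y : int) (g : R) : 0 <= g -> g < 1 -> Num.floor (y%:~R + g) = y.
  by move=> g0 g1; apply: floor_def; rewrite lerDl g0 intrD ltrD2l.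
by rewrite -(E z f)// zf E.
Qed.

End Preliminaries.

(** * Order of the moves and perturbation of the vertices *)

Section Vertices.
Context {R : realType}.

(* The strands move in turn, strand [i] in the steps congruent to [i] modulo
   [n]; [moves n i m] counts the moves of strand [i] before step [m]. *)
Definition moves (n i m : nat) : nat := (m + (n - i.+1)) %/ n.

Lemma moves_bounds n i m : (i < n)%N ->
  (n * moves n i m <= m + (n - i.+1) < n * moves n i m + n)%N.
Proof.
move=> ltin; have n0 : (0 < n)%N by exact: leq_ltn_trans ltin.
apply/andP; split; first by rewrite mulnC leq_divM.
by rewrite mulnC -[X in (_ < _ + X)%N]mul1n -mulnDl addn1 -ltn_divLR.
Qed.

Lemma moves0 n i : (i < n)%N -> moves n i 0 = 0%N.
Proof. by move=> ltin; rewrite /moves divn_small//; lia. Qed.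

Lemma moves_all n i N : (i < n)%N -> moves n i (n * N) = N.
Proof.
by move=> ltin; rewrite /moves mulnC divnMDl ?divn_small ?addn0//; lia.
Qed.

Lemma movesS n i m : (i < n)%N -> i != (m %% n)%N -> moves n i m.+1 = moves n i m.
Proof.
move=> ltin im; have /andP[b1 b2] := moves_bounds m ltin.
have /andP[c1 c2] := moves_bounds m.+1 ltin.
have n0 : (0 < n)%N by exact: leq_ltn_trans ltin.
set a := moves n i m in b1 b2 *; set b := moves n i m.+1 in c1 c2 *.
have ab : (a <= b)%N by rewrite -ltnS -(ltn_pmul2l n0) mulnS; lia.
have ba : (b <= a.+1)%N by rewrite -ltnS -(ltn_pmul2l n0) !mulnS; lia.
move: ba; rewrite leq_eqVlt => /orP[/eqP bE|]; last by lia.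
have mE : m = (a * n + i)%N.
  by move: c1; rewrite bE mulnS mulnC; lia.
by rewrite mE modnMDl modn_small// eqxx in im.
Qed.

Lemma moves_close n i m : (i < n)%N ->
  (n * moves n i m + 1 <= m + n)%N /\ (m + 1 <= n * moves n i m + n)%N.
Proof. by move=> ltin; have /andP[] := moves_bounds m ltin; lia. Qed.

(** Two strands are never more than one move apart. With more than one move per strand, no strand is
    still at its top vertex while another has reached its bottom vertex. *)
Lemma moves_le n i j m N : (i < n)%N -> (j < n)%N -> (m <= n * N)%N ->
  (moves n i m <= (moves n j m).+1)%N /\ (moves n i m <= N)%N.
Proof.
move=> ltin ltjn mN; have n0 : (0 < n)%N by exact: leq_ltn_trans ltin.
have [ci _] := moves_close m ltin; have [_ cj] := moves_close m ltjn.
by split; rewrite -ltnS -(ltn_pmul2l n0) !mulnS; lia.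
Qed.

(* Points perturbed with distinct [f] in [0, 1[ are distinct, since [f] is the
   fractional part of [B * perturb B f x]. *)
Definition perturb (B : nat) (f x : R) : R :=
  ((Num.floor (B%:R * x))%:~R + f) / B%:R.

Lemma perturb_close B f x : (0 < B)%N -> 0 <= f < 1 -> `|perturb B f x - x| <= B%:R^-1.
Proof.
move=> B0 /andP[f0 f1]; have B0' : 0 < B%:R :> R by rewrite ltr0n.
have -> : perturb B f x - x = ((Num.floor (B%:R * x))%:~R + f - B%:R * x) / B%:R.
  by rewrite /perturb; field; rewrite gt_eqF.
rewrite normrM [X in _ * X]gtr0_norm ?invr_gt0// ler_piMl ?invr_ge0 ?(ltW B0')//.
have := floor_le (B%:R * x); have := floorD1_gt (B%:R * x); rewrite intrD ler_norml => ? ?.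
by apply/andP; split; lra.
Qed.

End Vertices.

(** * Approximation by strands that move one at a time *)

Section Approximation.
Context {R : realType}.

Lemma convex_close (E : normedModType R) (a b x : E) (u e : R) :
  0 <= u <= 1 -> `|a - x| <= e -> `|b - x| <= e -> `|a + u *: (b - a) - x| <= e.
Proof.
move=> /andP[u0 u1] ae be.
have -> : a + u *: (b - a) - x = (1 - u) *: (a - x) + u *: (b - x).
  have -> : b - a = (b - x) - (a - x) by rewrite opprB addrA subrK.
  by rewrite addrAC scalerBl scale1r scalerBr -!addrA [- _ + u *: _]addrC.
apply: (le_trans (ler_normD _ _)); rewrite !normrZ (ger0_norm u0) ger0_norm ?subr_ge0//.
apply: (@le_trans _ _ ((1 - u) * e + u * e)); last by rewrite -mulrDl subrK mul1r.
by apply: lerD; apply: ler_wpM2l; rewrite ?subr_ge0.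
Qed.

(** Each strand makes [N] moves, in turn with the others, through the vertices [P i l], which sample
    [q i] at times l / N. The error [e] is shared between the perturbation of the vertices and the
    variation of [q i] over the delay caused by waiting for a turn. *)
Lemma pl_approx n (q : 'I_n -> R -> R * R) (sigma : 'S_n) (e : R) :
  (0 < n)%N -> 0 < e -> (forall i, continuous (q i)) ->
  (forall i, q i 0 = (i.+1%:R, 0)) -> (forall i, q i 1 = ((sigma i).+1%:R, 0)) ->
  exists (M : nat) (V : 'I_n -> nat -> R * R),
    [/\ (0 < M)%N,
        forall i, V i 0%N = q i 0 /\ V i M = q i 1,
        forall m i j, (m <= M)%N -> i != j -> (V i m).1 != (V j m).1,
        forall m, (m < M)%N -> exists k, forall i, i != k -> V i m.+1 = V i m
      & forall i s, 0 <= s <= 1 -> `|pl (V i) M (M%:R * s) - q i s| <= e].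
Proof.
move=> n0 e0 qc q0 q1; have e2 : 0 < e / 2 by rewrite divr_gt0.
have [d d0 dP] : exists2 d, 0 < d & forall i s t, 0 <= s <= 1 -> `|s - t| <= d ->
    `|q i s - q i t| <= e / 2.
  apply: (@finite_pos _ _ (fun i d => forall s t, 0 <= s <= 1 -> `|s - t| <= d ->
    `|q i s - q i t| <= e / 2)) => [i x y /andP[_ yx] xP s t s01 st|i].
    by apply: xP => //; exact: le_trans st yx.
  exact: segment_unif_continuous (qc i) e2.
have inv_small (x : R) : 0 < x -> exists2 N : nat, (1 < N)%N & N%:R^-1 <= x.
  move=> x0; exists (Num.truncn x^-1).+2 => //.
  rewrite invf_ple ?posrE ?ltr0n//.
  have := truncnS_gt x^-1; rewrite -[in leRHS]natr1; lra.
have [N N1 Nd] : exists2 N : nat, (1 < N)%N & N%:R^-1 <= d / 2.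
  by apply: inv_small; rewrite divr_gt0.
have [B /ltnW B0 Be] := inv_small _ e2.
have N0 : 0 < N%:R :> R by rewrite ltr0n ltnW.
have B0' : 0 < B%:R :> R by rewrite ltr0n.
have n0' : 0 < n%:R :> R by rewrite ltr0n.
pose stop l := (l == 0)%N || (N <= l)%N.
(* [l * n + i] numbers the pairs (l, i) injectively; adding 1 to both terms of the fraction keeps it
   strictly between 0 and 1 at interior vertices, away from the value 0 of the end points. *)
pose f (i : 'I_n) l : R := if stop l then 0 else (l * n + i).+1%:R / (N * n).+1%:R.
have T0 : 0 < (N * n).+1%:R :> R by rewrite ltr0n.
have f01 i l : 0 <= f i l < 1.
  rewrite /f; case: ifPn => [_|]; first by rewrite lexx ltr01.
  rewrite negb_or -ltnNge => /andP[_ lN]; rewrite divr_ge0//= ltr_pdivrMr// mul1r.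
  rewrite ltr_nat ltnS (leq_trans _ (leq_mul lN (leqnn n)))//.
  by rewrite mulSn -addnS [X in (_ <= X)%N]addnC leq_add2l.
(* Only the abscissa is perturbed: the projection does not see the depth. *)
pose P i l := if (l == 0)%N then q i 0 else if (N <= l)%N then q i 1 else
  (perturb B (f i l) (q i (l%:R / N%:R)).1, (q i (l%:R / N%:R)).2).
have Pint i l : exists z : int, (P i l).1 = (z%:~R + f i l) / B%:R.
  have natB (k : nat) : (k%:R : R) = ((B * k)%N%:Z%:~R + 0) / B%:R.
    by rewrite addr0 -pmulrn natrM mulrC mulKf// gt_eqF.
  rewrite /P; case: ifPn => [l0|_].
    by exists (B * i.+1)%N%:Z; rewrite q0 /f /stop l0/= -natB.
  case: ifPn => [Nl|_]; last by exists (Num.floor (B%:R * (q i (l%:R / N%:R)).1)).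
  by exists (B * (sigma i).+1)%N%:Z; rewrite q1 /f /stop Nl orbT/= -natB.
have Pclose i l : (l <= N)%N -> `|P i l - q i (l%:R / N%:R)| <= e / 2.
  move=> lN; rewrite /P; have [->|l0] := eqVneq l 0%N.
    by rewrite mul0r subrr normr0 ltW.
  have [Nl|Nl] := leqP N l.
    have -> : l = N by apply/eqP; rewrite eqn_leq lN.
    by rewrite divff ?gt_eqF// subrr normr0 ltW.
  rewrite prod_normE/= subrr normr0 ge_max (ltW e2) andbT.
  exact: le_trans (perturb_close _ B0 (f01 i l)) Be.
pose V i m := P i (moves n i m).
exists (n * N)%N, V; split.
- by rewrite muln_gt0 n0 ltnW.
- move=> i; rewrite /V moves0// moves_all// /P eqxx leqnn.
  by rewrite (gtn_eqF (ltnW N1)).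
- move=> m i j mM ij; rewrite /V.
  have [ll' lN] := moves_le (ltn_ord i) (ltn_ord j) mM.
  have [l'l l'N] := moves_le (ltn_ord j) (ltn_ord i) mM.
  set l := moves n i m in ll' lN l'l l'N *.
  set l' := moves n j m in ll' lN l'l l'N *.
  have [z zE] := Pint i l; have [z' zE'] := Pint j l'.
  apply/eqP => PP; have fE : f i l = f j l'.
    apply: (int_frac_inj (f01 i l) (f01 j l') (z := z) (z' := z')).
    have Bn : B%:R^-1 != 0 :> R by rewrite invr_eq0 gt_eqF.
    by apply: (mulIf Bn); rewrite -zE -zE'.
  have pos (k : 'I_n) a : (a * n + k).+1%:R / (N * n).+1%:R != 0 :> R.
    by rewrite mulf_neq0 ?invr_eq0 ?pnatr_eq0.
  move: fE; rewrite /f; case: ifPn => sl; case: ifPn => sl'.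
  + move=> _; move: sl sl'; rewrite /stop.
    have [l0|l0] := eqVneq l 0%N; have [l'0|l'0] := eqVneq l' 0%N => //=.
    * move=> _ _; move: PP; rewrite /P l0 l'0 eqxx !q0/= => /eqP.
      by rewrite eqr_nat eqSS; move/negP: ij.
    (* A top end and a bottom end could share an abscissa, but they do not occur at the same step
       since [1 < N]. *)
    * by move=> _ /leq_trans/(_ l'l); rewrite l0 leqNgt N1.
    * by move=> /leq_trans/(_ ll'); rewrite l'0 leqNgt N1.
    * move=> Nl Nl'; move: PP; rewrite /P (negbTE l0) (negbTE l'0) Nl Nl' !q1/=.
      move=> /eqP; rewrite eqr_nat eqSS => /eqP /val_inj /perm_inj ijE.
      by rewrite ijE eqxx in ij.
  + by move=> /esym/eqP; rewrite (negbTE (pos _ _)).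
  + by move=> /eqP; rewrite (negbTE (pos _ _)).
  + have Ti : (N * n).+1%:R^-1 != 0 :> R by rewrite invr_eq0 gt_eqF.
    move=> /(mulIf Ti) /eqP; rewrite eqr_nat eqSS => /eqP lij.
    have : ((l * n + i) %% n = (l' * n + j) %% n)%N by rewrite lij.
    by rewrite !modnMDl !modn_small// => /val_inj ijE; rewrite ijE eqxx in ij.
- move=> m _; exists (Ordinal (ltn_pmod m n0)) => i ik.
  by rewrite /V movesS//.
- move=> i s /andP[s0 s1].
  have nN0 : 0 < (n * N)%:R :> R by rewrite natrM mulr_gt0.
  have nNs : 0 <= (n * N)%:R * s <= (n * N)%:R by rewrite mulr_ge0// ler_piMr.
  have M0 : (0 < n * N)%N by rewrite muln_gt0 n0 ltnW.
  have [m [u [mM u01 sE]]] := step_of_closed M0 nNs.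
  (* Applied to both ends of the current step. The time of the vertex is off by less than [n] steps
     by [moves_close], and by one more step from [k] to the present, hence by at most n / (n N) = 1
     / N. *)
  have close k : (k <= n * N)%N -> `|k%:R - (n * N)%:R * s| <= 1 -> `|V i k - q i s| <= e.
    move=> kM; rewrite ler_norml => /andP[ks1 ks2].
    have [_ lN] := moves_le (ltn_ord i) (ltn_ord i) kM.
    have [b1 b2] := moves_close k (ltn_ord i).
    rewrite /V; set l := moves n i k in b1 b2 lN *.
    have : `|l%:R / N%:R - s| <= d.
      move: b1 b2; rewrite -!(ler_nat R) !natrD !natrM => b1 b2.
      have -> : l%:R / N%:R - s = (n%:R * l%:R - n%:R * N%:R * s) / (n%:R * N%:R).
        by field; rewrite !gt_eqF.
      rewrite natrM in ks1 ks2.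
      have close1 : `|n%:R * l%:R - n%:R * N%:R * s| <= n%:R.
        by rewrite ler_norml; apply/andP; split; lra.
      rewrite normrM [X in _ * X]gtr0_norm ?invr_gt0 ?mulr_gt0//.
      apply: (@le_trans _ _ (n%:R / (n%:R * N%:R))).
        by rewrite ler_wpM2r// invr_ge0 mulr_ge0 ?ltW.
      rewrite invfM mulrA divff ?gt_eqF// mul1r; lra.
    move=> ls; have := dP i _ _ _ ls.
    rewrite divr_ge0//= ler_pdivrMr// mul1r ler_nat lN => /(_ isT) h1.
    have := ler_distD (q i (l%:R / N%:R)) (P i l) (q i s); have := Pclose i _ lN; lra.
  rewrite sE plE//; apply: convex_close => //; have /andP[u0 u1] := u01; apply: close => //.
  + exact: ltnW.
  + by rewrite sE opprD addNKr normrN ger0_norm.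
  + by rewrite sE -natr1 opprD addrACA subrr add0r ger0_norm; lra.
Qed.

End Approximation.

(** * Strands of a braid as graphs over the height *)

Section Strands.
Context {R : realType}.

Lemma continuous_clamped (T : topologicalType) (f : R -> T) :
  {within `[0, 1], continuous f} -> continuous (f \o clamp).
Proof.
move=> /subspace_continuousP fc x.
have cx : `[0, 1]%classic (clamp x) by rewrite /= in_itv/= clamp_ge0 clamp_le1.
move=> B /(fc _ cx) fB.
apply: (@filterS _ (nbhs x) _ _ _ _ (@continuous_clamp R x _ fB)) => y /=; apply.
by rewrite /= in_itv/= clamp_ge0 clamp_le1.
Qed.

(** [1 - height] increases continuously from 0 to 1 along the strand, so its inverse is continuous
    and can be used to reparametrize; [clamp] then extends the result to all of R. *)
Lemma reparametrize_by_height (b : R -> space3 R) :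
  {within `[0, 1], continuous b} ->
  {in `[0, 1] &, forall s t, s < t -> height (b t) < height (b s)} ->
  height (b 0) = 1 -> height (b 1) = 0 ->
  exists q : R -> R * R,
    [/\ continuous q, forall s, q (clamp s) = q s,
        q 0 = planar (b 0), q 1 = planar (b 1)
      & b @` `[0, 1] = (fun s => lift (q s) (1 - s)) @` `[0, 1]].
Proof.
move=> bc bdec b0 b1.
pose h s := 1 - height (b s).
have h0 : h 0 = 0 by rewrite /h b0 subrr.
have h1 : h 1 = 1 by rewrite /h b1 subr0.
have hlt : {in `[0, 1] &, {homo h : s t / s < t}}.
  by move=> s t s01 t01 st; rewrite /h ltrD2l ltrN2; exact: bdec.
have hmono : {in `[0, 1] &, {mono h : s t / s <= t}} by exact: le_mono_in hlt.
have hinj : {in `[0, 1] &, injective h} by exact: inc_inj_in hmono.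
have hc : {within `[0, 1], continuous h}.
  move/subspace_continuousP : (bc) => bc'; apply/subspace_continuousP => x xA.
  apply: cvgB; first exact: cvg_cst.
  exact: (@continuous_cvg _ _ _ _ _ b (@height R) (b x)
           (@continuous_height R (b x)) (bc' x xA)).
have in0 : (0 : R) \in `[0, 1] by rewrite in_itv/= lexx ler01.
have in1 : (1 : R) \in `[0, 1] by rewrite in_itv/= lexx ler01.
have /choice[psi psiP] : forall y, exists s, y \in `[0, 1] -> s \in `[0, 1] /\ h s = y.
  move=> y; have [y01|_] := boolP (y \in `[0, 1]); last by exists 0.
  have [|c c01 hcy] := @IVT R h 0 1 y ler01 hc.
    rewrite h0 h1 (min_l ler01) (max_r ler01); move: y01; rewrite in_itv/=; exact.
  by exists c.
have hin s : s \in `[0, 1] -> h s \in `[0, 1].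
  move=> s01; rewrite in_itv/=; move: (s01); rewrite [in X in X -> _]in_itv/= => /andP[s0 s1].
  by rewrite -[leLHS]h0 -[X in _ && (_ <= X)]h1 !hmono ?s0.
have psih s : s \in `[0, 1] -> psi (h s) = s.
  by move=> s01; have [ps phs] := psiP _ (hin _ s01); apply: hinj.
have psic : {within `[0, 1], continuous psi}.
  apply: segment_inc_surj_continuous.
    move=> x y /psiP[px hx] /psiP[py hy]; by rewrite -[in RHS]hx -[in RHS]hy hmono.
  have -> : psi 0 = 0 by rewrite -[in LHS]h0 psih.
  have -> : psi 1 = 1 by rewrite -[in LHS]h1 psih.
  by move=> s /= s01; exists (h s); [exact: hin|exact: psih].
have clamp01 (s : R) : clamp s \in `[0, 1] by rewrite in_itv/= clamp_ge0 clamp_le1.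
have qE s : s \in `[0, 1] -> lift (planar (b (psi (clamp s)))) (1 - s) = b (psi s).
  move=> s01; have [p01 hp] := psiP _ s01.
  rewrite clamp_id; last by move: s01; rewrite in_itv.
  by rewrite -{2}hp /h subKr lift_planar.
exists (fun s => planar (b (psi (clamp s)))); split.
- move=> s.
  have bcc := continuous_clamped bc; have pcc := continuous_clamped psic.
  have -> : (fun s => planar (b (psi (clamp s)))) =
      planar \o ((b \o clamp) \o (psi \o clamp)).
    apply/funext => t /=; rewrite (@clamp_id _ (psi _))//.
    by have [+ _] := psiP _ (clamp01 t); rewrite in_itv.
  apply: continuous_comp; last exact: continuous_planar.
  by apply: continuous_comp; [exact: pcc|exact: bcc].
- by move=> s; rewrite clampK.
- by rewrite clamp_le0// -{1}h0 psih.
- by rewrite clamp_ge1// -{1}h1 psih.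
- apply/seteqP; split=> p [s s01 <-].
    by exists (h s); [exact: hin|rewrite qE ?psih//; exact: hin].
  by exists (psi s); [have [] := psiP _ s01|rewrite qE].
Qed.

(** With the height as parameter, disjointness says that distinct strands differ at each time. The
    distances between strands and to the plane x = 0 attain positive minima on [0, 1], and [r] is
    the least of them. *)
Lemma braid_strands n (beta : 'I_n -> R -> space3 R) : braid beta ->
  exists (q : 'I_n -> R -> R * R) (sigma : 'S_n) (r : R),
    [/\ forall i, continuous (q i) /\ (forall s, q i (clamp s) = q i s),
        forall i, q i 0 = (i.+1%:R, 0) /\ q i 1 = ((sigma i).+1%:R, 0),
        0 < r /\ (forall i s, r <= (q i s).1),
        forall i j s, i != j -> r <= `|q i s - q j s|
      & forall i, beta i @` `[0, 1] = (fun s => lift (q i s) (1 - s)) @` `[0, 1]].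
Proof.
move=> [bc bdec [b0 [sigma b1]] bpos btriv].
have /choice[q qP] : forall i : 'I_n, exists q : R -> R * R,
    [/\ continuous q, forall s, q (clamp s) = q s,
        q 0 = (i.+1%:R, 0), q 1 = ((sigma i).+1%:R, 0)
      & beta i @` `[0, 1] = (fun s => lift (q s) (1 - s)) @` `[0, 1]].
  move=> i.
  have [|| q [qc qcl q0 q1 qE]] := @reparametrize_by_height (beta i) (bc i) (bdec i).
  - by rewrite b0.
  - by rewrite b1.
  by exists q; split => //; [rewrite q0 b0|rewrite q1 b1].
have clamp01 (s : R) : clamp s \in `[0, 1] by rewrite in_itv/= clamp_ge0 clamp_le1.
have on_strand i s : s \in `[0, 1] -> (beta i @` `[0, 1]) (lift (q i s) (1 - s)).
  by move=> s01; have [_ _ _ _ ->] := qP i; exists s.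
have [r1 r10 r1P] : exists2 r, 0 < r & forall i s, r <= (q i s).1.
  apply: (@finite_pos _ _ (fun i r => forall s, r <= (q i s).1)) => [i x y /andP[_ yx] H s|i].
    exact: le_trans yx (H s).
  have [qc qcl _ _ _] := qP i.
  have qc1 : continuous (fun s => (q i s).1).
    move=> s; exact: (@continuous_cvg _ _ _ _ _ (q i) fst (q i s)
                       (@continuous_fst _ _ _) (qc s)).
  have [c c01 cmin] := EVT_min ler01 (continuous_subspaceT qc1).
  exists (q i c).1; last by move=> s; rewrite -(qcl s); exact: cmin.
  have [t t01 tE] := on_strand i c c01.
  by have := bpos i t t01; rewrite tE.
have [r2 r20 r2P] : exists2 r, 0 < r & forall ij : 'I_n * 'I_n, ij.1 != ij.2 ->
    forall s, r <= `|q ij.1 s - q ij.2 s|.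
  apply: (@finite_pos _ _ (fun (ij : 'I_n * 'I_n) r => ij.1 != ij.2 ->
    forall s, r <= `|q ij.1 s - q ij.2 s|)) => [ij x y /andP[_ yx] H ijn s|[i j]/=].
    exact: le_trans yx (H ijn s).
  have [->|ij] := eqVneq i j; first by exists 1.
  have [qic qicl _ _ _] := qP i; have [qjc qjcl _ _ _] := qP j.
  have nc : continuous (fun s => `|q i s - q j s|).
    by move=> s; apply: cvg_norm; apply: cvgB; [exact: qic|exact: qjc].
  have [c c01 cmin] := EVT_min ler01 (continuous_subspaceT nc).
  exists `|q i c - q j c|; last by move=> _ s; rewrite -(qicl s) -(qjcl s); exact: cmin.
  rewrite normr_gt0 subr_eq0; apply/eqP => qij.
  have := on_strand i c c01; have := on_strand j c c01; rewrite qij => pj pi.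
  by move/eqP: ij; apply; apply: (btriv i j I I); eexists; split; [exact: pi|exact: pj].
exists q, sigma, (Num.min r1 r2); split.
- by move=> i; have [] := qP i.
- by move=> i; have [] := qP i.
- by split=> [|i s]; [rewrite lt_min r10|rewrite ge_min r1P].
- by move=> i j s ij; rewrite ge_min (r2P (i, j) ij) orbT.
- by move=> i; have [] := qP i.
Qed.

End Strands.

(** * The closed curve *)

Section Arcs.
Context {R : realType}.
Implicit Types (c u : R).

(* The corners of the closing arc, from its bottom end to its top end. *)
Definition corner c (k : nat) : R * R :=
  nth (c, 1) [:: (c, 0); (c, - c); (- c, - c); (- c, 1 + c); (c, 1 + c)] k.

(** Five steps need six corners: the sixth, the top end (c, 1), is the default value of [nth] in
    [corner]. *)
Definition arc c u : space3 R :=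
  let p := pl (corner c) 5 (5%:R * u) in pt p.1 p.2 0.

Lemma arc_clamped c u : arc c (clamp u) = arc c u.
Proof.
rewrite /arc; have := @concat_clamped R _ (pl_step (corner c)) 5 _ u.
by rewrite /pl => ->//; exact: pl_step_clamped.
Qed.

Lemma arcE c k w : (k < 5)%N -> 0 <= w <= 1 ->
  arc c ((k%:R + w) / 5%:R) =
    pt ((corner c k).1 + w * ((corner c k.+1).1 - (corner c k).1))
       ((corner c k).2 + w * ((corner c k.+1).2 - (corner c k).2)) 0.
Proof. by move=> k5 w01; rewrite /arc mulrC divfK ?pnatr_eq0// plE. Qed.

Lemma arc_cases c u : 0 <= u <= 1 ->
  exists k w, [/\ (k < 5)%N, 0 <= w <= 1, 5%:R * u = k%:R + w &
    arc c u = pt ((corner c k).1 + w * ((corner c k.+1).1 - (corner c k).1))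
                 ((corner c k).2 + w * ((corner c k.+1).2 - (corner c k).2)) 0].
Proof.
move=> /andP[u0 u1]; have [//||k [w [k5 w01 uE]]] := @step_of_closed R 5 (5%:R * u).
  by apply/andP; split; lra.
have uE' : u = (k%:R + w) / 5%:R by rewrite -uE mulrC mulKf ?pnatr_eq0.
by exists k, w; split; [exact: k5|exact: w01|exact: uE|rewrite {1}uE'; exact: arcE].
Qed.

Lemma arc0 c : arc c 0 = pt c 0 0.
Proof.
have u0 : (0%:R + 0) / 5%:R = 0 :> R by rewrite addr0 mul0r.
by rewrite -[in LHS]u0 (@arcE c 0 0) ?lexx ?ler01//= !mul0r !addr0.
Qed.

Lemma arc1 c : arc c 1 = pt c 1 0.
Proof.
have u1 : (4%:R + 1) / 5%:R = 1 :> R by field.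
rewrite -[in LHS]u1 (@arcE c 4 1) ?lexx ?ler01//= !mul1r.
by congr (_, _, _); rewrite /=; lra.
Qed.

Lemma continuous_arc c : continuous (arc c).
Proof.
have plc : continuous (pl (corner c) 5).
  by have [L plL] := pl_lip (corner c) 5; exact: (@lip_continuous _ R^o _ L).
have c5 : continuous (fun u : R => 5%:R * u) by move=> u; exact: mulrl_continuous.
have pc u : pl (corner c) 5 (5%:R * x) @[x --> u] --> pl (corner c) 5 (5%:R * u).
  exact: (@continuous_cvg _ _ _ _ _ _ _ _ (plc _) (c5 u)).
move=> u; apply: cvg_pair_nbhs; last exact: cvg_cst.
apply: cvg_pair_nbhs.
  exact: (@continuous_cvg _ _ _ _ _ _ fst _ (@continuous_fst _ _ _) (pc u)).
exact: (@continuous_cvg _ _ _ _ _ _ snd _ (@continuous_snd _ _ _) (pc u)).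
Qed.

Definition on_rectangle c (p : R * R) :=
  [/\ - c <= p.1 <= c, - c <= p.2 <= 1 + c
    & [\/ p.1 = c, p.1 = - c, p.2 = - c | p.2 = 1 + c]].

Lemma arc_on_rectangle c u : 1 <= c -> 0 <= u <= 1 ->
  on_rectangle c (plane_proj (arc c u)).
Proof.
move=> c1 /(@arc_cases c)[k [w [k5 /andP[w0 w1] _ ->]]].
have [cw0 cw1] : 0 <= c * w /\ c * w <= c by split; nra.
rewrite /on_rectangle /plane_proj /corner.
case: k k5 => [|[|[|[|[|//]]]]] _ /=; split; try (apply/andP; split; nra).
- by apply: Or41; lra.
- by apply: Or43; lra.
- by apply: Or42; lra.
- by apply: Or44; lra.
- by apply: Or41; lra.
Qed.

Lemma on_rectangle_inj c c' p : on_rectangle c p -> on_rectangle c' p -> c = c'.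
Proof.
move=> [/andP[? ?] /andP[? ?] H] [/andP[? ?] /andP[? ?] H'].
by case: H => ?; case: H' => ?; lra.
Qed.

Lemma arc_proj_inj c u u' : 1 <= c -> 0 <= u <= 1 -> 0 <= u' <= 1 ->
  plane_proj (arc c u) = plane_proj (arc c u') -> u = u'.
Proof.
move=> c1 /(@arc_cases c)[k [w [k5 /andP[w0 w1] uE ->]]].
move=> /(@arc_cases c)[k' [w' [k5' /andP[w0' w1'] uE' ->]]].
have [cw0 cw1] : 0 <= c * w /\ c * w <= c by split; nra.
have [cw0' cw1'] : 0 <= c * w' /\ c * w' <= c by split; nra.
(* The goal is multiplied by [c], so that everything is linear in [c], [w], [w'] and the products
   [c * w], [c * w']. The left edge, of length 1 + 2c, gives an equation in w + 2cw, which [ww]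
   resolves. *)
suff H : plane_proj (pt ((corner c k).1 + w * ((corner c k.+1).1 - (corner c k).1))
    ((corner c k).2 + w * ((corner c k.+1).2 - (corner c k).2)) 0) =
  plane_proj (pt ((corner c k').1 + w' * ((corner c k'.+1).1 - (corner c k').1))
    ((corner c k').2 + w' * ((corner c k'.+1).2 - (corner c k').2)) 0) ->
    c * k%:R + c * w = c * k'%:R + c * w'.
  move=> /H; rewrite -!mulrDr -uE -uE'.
  have c0 : c != 0 by rewrite gt_eqF//; lra.
  by move=> /(mulfI c0); lra.
have ww : w + 2 * (c * w) = w' + 2 * (c * w') -> c * w = c * w'.
  move=> h; have : (1 + 2 * c) * (w - w') = 0 by lra.
  by move=> /eqP; rewrite mulf_eq0 => /orP[/eqP ?|/eqP ?]; [lra|have -> : w = w' by lra].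
rewrite /plane_proj /pt /corner => -[].
case: k k5 {uE} => [|[|[|[|[|//]]]]] _;
  case: k' k5' {uE'} => [|[|[|[|[|//]]]]] _ /= ex ey;
  rewrite ?mulr0n ?mulr1n; lra.
Qed.

Lemma arc_outside c u : 1 <= c -> 0 <= u <= 1 ->
  let p := plane_proj (arc c u) in [\/ 1 <= p.2, p.2 <= 0 | p.1 <= 0].
Proof.
move=> c1 /(@arc_cases c)[k [w [k5 /andP[w0 w1] _ ->]]].
have [cw0 cw1] : 0 <= c * w /\ c * w <= c by split; nra.
rewrite /plane_proj /corner.
case: k k5 => [|[|[|[|[|//]]]]] _ /=.
- by apply: Or32; lra.
- by apply: Or32; lra.
- by apply: Or33; lra.
- by apply: Or31; lra.
- by apply: Or31; lra.
Qed.

(** The strands project into x > 0, 0 <= y <= 1; strictness inside the arc therefore excludes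
    crossings between arcs and strands. *)
Lemma arc_outside_strict c u : 1 <= c -> 0 < u < 1 ->
  let p := plane_proj (arc c u) in [\/ 1 < p.2, p.2 < 0 | p.1 < 0].
Proof.
move=> c1 /andP[u0 u1]; have u01 : 0 <= u <= 1 by rewrite !ltW.
have [k [w [k5 /andP[w0 w1] uE ->]]] := arc_cases c u01.
have [cw0 cw1] : 0 <= c * w /\ c * w <= c by split; nra.
rewrite /plane_proj /corner.
case: k k5 uE => [|[|[|[|[|//]]]]] _ /= uE.
- by apply: Or32; nra.
- by apply: Or32; lra.
- by apply: Or33; lra.
- by apply: Or31; lra.
- by apply: Or31; nra.
Qed.

(** [closing_arc] lists the corners from the top end and [arc] from the bottom end, so each segment
    is run backwards, with parameter [1 - w]. *)
Lemma range_arc i : arc i.+1%:R @` `[0, 1] = @closing_arc R i.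
Proof.
rewrite /closing_arc; set c := i.+1%:R.
pose P k := pt (corner c k).1 (corner c k).2 0.
have seg k : (k < 5)%N ->
    [set arc c ((k%:R + w) / 5%:R) | w in `[0, 1]] = segment (P k.+1) (P k).
  move=> k5; rewrite /segment; apply/seteqP; split=> p [w]; rewrite /= in_itv/= => w01 <-.
    exists (1 - w).
      by rewrite /= in_itv/=; move: w01 => /andP[? ?]; apply/andP; split; lra.
    rewrite arcE//; congr (_, _, _) => /=; rewrite /GRing.scale/=; ring.
  have w01' : 0 <= 1 - w <= 1 by move: w01 => /andP[? ?]; apply/andP; split; lra.
  exists (1 - w); first by rewrite /= in_itv.
  rewrite arcE//; congr (_, _, _) => /=; rewrite /GRing.scale/=; ring.
apply/seteqP; split=> p.
  move=> [u]; rewrite /= in_itv/= => u01 <-.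
  have [k [w [k5 w01 uE _]]] := arc_cases c u01.
  have : segment (P k.+1) (P k) (arc c u).
    have uE' : u = (k%:R + w) / 5%:R by rewrite -uE mulrC mulKf ?pnatr_eq0.
    by rewrite -(seg k k5) uE'; exists w; [rewrite /= in_itv|].
  case: k k5 {uE} => [|[|[|[|[|//]]]]] _ H.
  - by right; right; right; right; left.
  - by right; right; right; left.
  - by right; right; left.
  - by right; left.
  - by left.
have sub k : (k < 5)%N -> segment (P k.+1) (P k) `<=` arc c @` `[0, 1].
  move=> k5; rewrite -(seg k k5) => _ [w w01 <-].
  exists ((k%:R + w) / 5%:R); last by [].
  move: w01; rewrite /= !in_itv/= => /andP[w0 w1].
  rewrite divr_ge0 ?addr_ge0//= ler_pdivrMr ?ltr0n// mul1r.
  have : k.+1%:R <= 5%:R :> R by rewrite ler_nat.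
  by rewrite -natr1; lra.
case=> [|[|[|[|[|->]]]]].
- exact: (sub 4%N).
- exact: (sub 3%N).
- exact: (sub 2%N).
- exact: (sub 1%N).
- exact: (sub 0%N).
by exists 0; [rewrite /= in_itv/= lexx ler01|rewrite arc0].
Qed.

End Arcs.

Opaque arc.

(** * Each strand followed by its closing arc *)

Section Loops.
Context {R : realType} (n M : nat) (sigma : 'S_n) (V : 'I_n -> nat -> R * R).

Definition pl_strand (i : 'I_n) (s : R) : R * R := pl (V i) M (M%:R * s).

Definition strand (i : 'I_n) (s : R) : space3 R :=
  lift (pl_strand i s) (1 - clamp s).

Definition loop (i : 'I_n) (w : R) : space3 R :=
  concat (fun k => if k is 0%N then strand i else arc (sigma i).+1%:R) 2 (2%:R * w).

(* [pl_distinct] and [pl_one_move] exclude triple points: of three strands two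
   do not move in a given step, and those are vertical and apart. *)
Record pl_braid : Prop := PLBraid {
  pl_strands_gt0 : (0 < n)%N;
  pl_steps_gt0 : (0 < M)%N;
  pl_top : forall i, V i 0%N = (i.+1%:R, 0);
  pl_bottom : forall i, V i M = ((sigma i).+1%:R, 0);
  pl_distinct : forall m i j, (m <= M)%N -> i != j -> (V i m).1 != (V j m).1;
  pl_one_move : forall m, (m < M)%N -> exists k, forall i, i != k -> V i m.+1 = V i m;
  pl_right : forall i s, 0 < (pl_strand i s).1;
  pl_disjoint : forall i j s, i != j -> pl_strand i s <> pl_strand j s }.

Lemma pl_strand_clamped i s : pl_strand i (clamp s) = pl_strand i s.
Proof. exact: (@concat_clamped _ _ _ M (@pl_step_clamped _ _ (V i))). Qed.

Lemma pl_strandE i m u : (m < M)%N -> 0 <= u <= 1 ->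
  pl_strand i ((m%:R + u) / M%:R) = V i m + u *: (V i m.+1 - V i m).
Proof.
move=> mM u01; have M0 : M%:R != 0 :> R by rewrite pnatr_eq0 -lt0n; exact: leq_trans mM.
by rewrite /pl_strand mulrC divfK// plE.
Qed.

Lemma pl_strand_lip i :
  exists L, forall s t, `|pl_strand i s - pl_strand i t| <= L * `|s - t|.
Proof.
have [L plL] := pl_lip (V i) M; exists (L * M%:R) => s t.
apply: (le_trans (plL _ _)); rewrite -mulrBr normrM (ger0_norm (ler0n _ _)).
by rewrite mulrA.
Qed.

Lemma continuous_pl_strand i : continuous (pl_strand i).
Proof.
by have [L plL] := pl_strand_lip i; exact: (@lip_continuous _ R^o _ L).
Qed.

Lemma strand_clamped i s : strand i (clamp s) = strand i s.
Proof. by rewrite /strand pl_strand_clamped clampK. Qed.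

Lemma continuous_strand i : continuous (strand i).
Proof.
move=> s; apply: cvg_lift; first exact: continuous_pl_strand.
by apply: cvgB; [exact: cvg_cst|exact: continuous_clamp].
Qed.

Lemma pieces_clamped i k :
  clamped (if k is 0%N then strand i else arc (sigma i).+1%:R).
Proof. by case: k => [|k] s; [exact: strand_clamped|exact: arc_clamped]. Qed.

Lemma loop_clamped i w : loop i (clamp w) = loop i w.
Proof. exact: (@concat_clamped _ _ _ 2 (@pieces_clamped i)). Qed.

Lemma continuous_loop i : continuous (loop i).
Proof.
have cc : continuous (concat (fun k => if k is 0%N then strand i
                                       else arc (sigma i).+1%:R) 2).
  apply: continuous_concat => -[|k]; first exact: continuous_strand.
  exact: continuous_arc.
move=> w; exact: (@continuous_comp _ _ _ (fun w : R => 2%:R * w) _ w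
  (@mulrl_continuous _ _ _) (cc _)).
Qed.

Context (B : pl_braid).

Lemma strand0 i : strand i 0 = pt i.+1%:R 1 0.
Proof.
rewrite /strand clamp_le0// subr0; have := @pl_strandE i 0 0 (pl_steps_gt0 B).
rewrite lexx ler01 addr0 mul0r scale0r addr0 => ->//.
by rewrite (pl_top B).
Qed.

Lemma strand1 i : strand i 1 = arc (sigma i).+1%:R 0.
Proof.
have M0 := pl_steps_gt0 B; have Mp : (M.-1 < M)%N by rewrite ltn_predL.
have M0' : M%:R != 0 :> R by rewrite pnatr_eq0 -lt0n.
rewrite arc0 /strand clamp_ge1// subrr; have := @pl_strandE i _ 1 Mp.
rewrite lexx ler01 natr1 prednK// divff// scale1r addrC subrK => ->//.
by rewrite (pl_bottom B).
Qed.

Lemma pieces_chain i k : (k.+1 < 2)%N ->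
  (if k is 0%N then strand i else arc (sigma i).+1%:R) 1 =
  (if k.+1 is 0%N then strand i else arc (sigma i).+1%:R) 0.
Proof. by case: k => [|k] k2; [exact: strand1|exfalso; exact: (notF k2)]. Qed.

Lemma loop_strand i w : 0 <= w <= 2^-1 -> loop i w = strand i (2%:R * w).
Proof.
move=> /andP[w0 w1].
have w01 : 0 <= 2%:R * w <= 1 by apply/andP; split; lra.
have := concatE (@pieces_clamped i) (@pieces_chain i) (isT : (0 < 2)%N) w01.
by rewrite add0r.
Qed.

Lemma loop_arc i w : 2^-1 <= w <= 1 -> loop i w = arc (sigma i).+1%:R (2%:R * w - 1).
Proof.
move=> /andP[w0 w1].
have w01 : 0 <= 2%:R * w - 1 <= 1 by apply/andP; split; lra.
have := concatE (@pieces_clamped i) (@pieces_chain i) (isT : (1 < 2)%N) w01.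
by rewrite addrC subrK.
Qed.

Lemma loop0 i : loop i 0 = pt i.+1%:R 1 0.
Proof.
have w0 : 0 <= (0 : R) <= 2^-1 by apply/andP; split; lra.
by rewrite (loop_strand i w0) mulr0; exact: strand0.
Qed.

Lemma loop1 i : loop i 1 = loop (sigma i) 0.
Proof.
have w1 : 2^-1 <= (1 : R) <= 1 by apply/andP; split; lra.
have e1 : 2%:R * 1 - 1 = 1 :> R by lra.
by rewrite loop0 (loop_arc i w1) e1; exact: arc1.
Qed.

(** Double points occur only between distinct strands, and at equal parameters: on strands the
    parameter is read off from the height, strands miss the interiors of arcs, and different arcs
    lie on disjoint nested rectangles. *)
Lemma loop_proj_eq i j w w' : 0 <= w < 1 -> 0 <= w' < 1 ->
  plane_proj (loop i w) = plane_proj (loop j w') ->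
  w = w' /\ (i = j \/ i != j /\ w <= 2^-1).
Proof.
have c1 (k : 'I_n) : 1 <= (sigma k).+1%:R :> R by rewrite ler1n.
have strand_arc k l v v' : 0 <= v <= 2^-1 -> 2^-1 < v' < 1 ->
    plane_proj (loop k v) <> plane_proj (loop l v').
  move=> v01 /andP[v'0 v'1]; rewrite loop_strand// loop_arc; last first.
    by apply/andP; split; lra.
  have u01 : 0 < 2%:R * v' - 1 < 1 by apply/andP; split; lra.
  move=> E; have := arc_outside_strict (c1 l) u01; rewrite -E /=.
  have := clamp_ge0 (2%:R * v); have := clamp_le1 (2%:R * v).
  have := pl_right B k (2%:R * v).
  rewrite /strand /lift /plane_proj /pt /= => ? ? ? [?|?|?]; lra.
move=> /andP[w0 w1] /andP[w'0 w'1] E.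
have [wl|wl] := leP w 2^-1; have [wl'|wl'] := leP w' 2^-1.
- move: E; rewrite !loop_strand ?w0 ?w'0// => -[_].
  rewrite !clamp_id; try by apply/andP; split; lra.
  move=> ww; split; first lra.
  by have [->|ij] := eqVneq i j; [left|right].
- by case: (@strand_arc i j w w' _ _ E); apply/andP; split.
- by case: (@strand_arc j i w' w _ _ (esym E)); apply/andP; split.
have u01 : 0 <= 2%:R * w - 1 <= 1 by apply/andP; split; lra.
have u01' : 0 <= 2%:R * w' - 1 <= 1 by apply/andP; split; lra.
move: E; rewrite !loop_arc; try by apply/andP; split; lra.
move=> E; have Q := arc_on_rectangle (c1 i) u01; have Q' := arc_on_rectangle (c1 j) u01'.
have /eqP : (sigma i).+1%:R = (sigma j).+1%:R :> R.
  by apply: (@on_rectangle_inj _ _ _ (plane_proj (arc (sigma i).+1%:R (2%:R * w - 1))));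
    [exact: Q|rewrite E; exact: Q'].
rewrite eqr_nat eqSS => /eqP /val_inj /perm_inj ij; rewrite -ij in E *.
split; last by left.
by have := arc_proj_inj (c1 i) u01 u01' E; lra.
Qed.

Lemma loop_inj i j w w' : 0 <= w < 1 -> 0 <= w' < 1 -> loop i w = loop j w' ->
  i = j /\ w = w'.
Proof.
move=> w01 w01' E; have [ww [ij|[ij wl]]] := loop_proj_eq w01 w01' (congr1 _ E).
  by split; [exact: ij|exact: ww].
have /andP[w0 w1] := w01.
move: E; rewrite -ww !loop_strand ?w0//.
move=> /(congr1 (@planar R)); rewrite /strand !planar_lift => /(pl_disjoint B ij).
by [].
Qed.

End Loops.

Opaque loop.

(** * Connectedness makes the permutation a single cycle *)

Section Link.
Context {R : realType} (n M : nat) (sigma : 'S_n) (V : 'I_n -> nat -> R * R).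
Context (B : pl_braid M sigma V).

Let loop := loop M sigma V.

Definition link : set (space3 R) := \bigcup_(i in setT) (loop i @` `[0, 1]).

Lemma loop_halfopen i w : 0 <= w <= 1 ->
  exists j w', [/\ 0 <= w' < 1, j = i \/ j = sigma i & loop i w = loop j w'].
Proof.
move=> /andP[w0]; rewrite le_eqVlt => /orP[/eqP ->|w1].
  by exists (sigma i), 0; split; [rewrite lexx ltr01|right|exact: loop1].
by exists i, w; split; [rewrite w0|left|].
Qed.

(** The loops indexed by the orbit of [i] and the remaining loops form two disjoint closed sets
    covering the link, and the first is not empty. They are disjoint because a loop ends where the
    loop of its image under [sigma] starts, in the same orbit, and loops are injective on [0, 1[. *)
Lemma connected_link_orbit : connected link ->
  forall i j, j \in fingraph.orbit sigma i.
Proof.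
move=> conn i j.
have orbitS k : (sigma k \in fingraph.orbit sigma i) = (k \in fingraph.orbit sigma i).
  rewrite -!fconnect_orbit; apply/idP/idP => ik; apply: (connect_trans ik).
    by rewrite (fconnect_sym (@perm_inj _ sigma)) fconnect1.
  exact: fconnect1.
pose part (b : bool) :=
  \bigcup_(k in [set k | (k \in fingraph.orbit sigma i) == b]) (loop k @` `[0, 1]).
have part_closed b : closed (part b).
  apply: closed_bigcup => [|k _]; first exact: finite_finset.
  apply: compact_closed; first exact: norm_hausdorff.
  apply: continuous_compact; last exact: segment_compact.
  by apply: continuous_subspaceT; exact: continuous_loop.
have part_disj : part true `&` part false = set0.
  apply/seteqP; split=> // p [[k /= /eqP kO [w /= w01 <-]]].
  move=> [l /= /eqP lO [w' /= w01' E]].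
  rewrite in_itv/= in w01; rewrite in_itv/= in w01'.
  have [k' [v [v01 kk' kE]]] := loop_halfopen k w01.
  have [l' [v' [v01' ll' lE]]] := loop_halfopen l w01'.
  rewrite kE lE in E; have [kl _] := loop_inj B v01' v01 E.
  have : (k' \in fingraph.orbit sigma i) = true by case: kk' => ->; rewrite ?orbitS.
  by rewrite -kl; case: ll' => ->; rewrite ?orbitS lO.
have linkE : link = part true `|` part false.
  apply/seteqP; split=> p.
    move=> [k _ pk]; case kO : (k \in fingraph.orbit sigma i); [left|right];
      by exists k => //=; rewrite kO.
  by case=> -[k _ pk]; exists k.
have partE : part true = link.
  apply: conn.
  - exists (loop i 0), i; first by rewrite /= -fconnect_orbit connect0.
    by exists 0 => //=; rewrite in_itv/= lexx ler01.
  - exists (~` part false); first exact: closed_openC.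
    rewrite linkE setIUl setICr setU0; apply/esym/setIidl => p pt pf.
    by have : (part true `&` part false) p by []; rewrite part_disj.
  - exists (part true) => //; rewrite linkE setIUl setIid [X in _ `|` X]setIC part_disj.
    by rewrite setU0.
have : link (loop j 0).
  by exists j => //; exists 0 => //=; rewrite in_itv/= lexx ler01.
rewrite -partE => -[k /= /eqP kO [w /= w01 E]].
rewrite in_itv/= in w01; have [k' [v [v01 kk' kE]]] := loop_halfopen k w01.
have v01' : 0 <= (0 : R) < 1 by rewrite lexx ltr01.
rewrite kE in E; have [<- _] := loop_inj B v01 v01' E.
by case: kk' => ->; rewrite ?orbitS.
Qed.

End Link.

(** * The closed braid as one closed curve *)

Section Curve.
Context {R : realType} (n M : nat) (sigma : 'S_n) (V : 'I_n -> nat -> R * R).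
Context (B : pl_braid M sigma V).
Context (orb : forall i j, j \in fingraph.orbit sigma i).

Let loop := loop M sigma V.

Definition nth_strand (l : nat) : 'I_n := iter l sigma (Ordinal (pl_strands_gt0 B)).

Lemma order_sigma i : fingraph.order sigma i = n.
Proof.
rewrite /fingraph.order -[RHS]card_ord; apply: eq_card => j.
by rewrite inE; have := orb i j; rewrite -fconnect_orbit.
Qed.

Lemma nth_strand_inj l l' : (l < n)%N -> (l' < n)%N ->
  nth_strand l = nth_strand l' -> l = l'.
Proof.
move=> ln ln' ll'; have := orbit_uniq sigma (Ordinal (pl_strands_gt0 B)).
rewrite /fingraph.orbit order_sigma => u.
apply/eqP; rewrite -(nth_uniq (Ordinal (pl_strands_gt0 B)) _ _ u) ?size_traject//.
by rewrite !nth_traject//; exact/eqP.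
Qed.

Lemma nth_strand_n : nth_strand n = nth_strand 0.
Proof.
have := iter_order (@perm_inj _ sigma) (Ordinal (pl_strands_gt0 B)).
by rewrite order_sigma.
Qed.

Lemma nth_strand_surj i : exists2 l, (l < n)%N & nth_strand l = i.
Proof.
have := orb (Ordinal (pl_strands_gt0 B)) i.
by rewrite /fingraph.orbit order_sigma => /trajectP[l ln ->]; exists l.
Qed.

Definition circuit (x : R) : space3 R :=
  concat (fun l => loop (nth_strand l)) n (n%:R * x).
Definition curve (t : R) : space3 R := circuit (t - (Num.floor t)%:~R).

Let n_gt0 : 0 < n%:R :> R. Proof. by rewrite ltr0n; exact: pl_strands_gt0 B. Qed.

Lemma circuit_clamped x : circuit (clamp x) = circuit x.
Proof. by apply: (@concat_clamped _ _ _ n) => l w; exact: loop_clamped. Qed.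

Lemma circuitE l w : (l < n)%N -> 0 <= w <= 1 ->
  circuit ((l%:R + w) / n%:R) = loop (nth_strand l) w.
Proof.
move=> ln w01; rewrite /circuit mulrC divfK ?gt_eqF//.
apply: concatE; [| |exact: ln|exact: w01].
  by move=> k u; exact: loop_clamped.
by move=> k _; exact: loop1.
Qed.

Lemma circuit01 : circuit 1 = circuit 0.
Proof.
have n0 := pl_strands_gt0 B; have np : (n.-1 < n)%N by rewrite ltn_predL.
have w1 : 0 <= (1 : R) <= 1 by rewrite ler01 lexx.
have w0 : 0 <= (0 : R) <= 1 by rewrite ler01 lexx.
have nn0 : n%:R != 0 :> R by rewrite gt_eqF.
have lastE : sigma (nth_strand n.-1) = nth_strand 0.
  by have := nth_strand_n; rewrite -[X in nth_strand X](prednK n0).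
have E1 := circuitE np w1; rewrite natr1 (prednK n0) (divff nn0) in E1.
have E0 := circuitE n0 w0; rewrite addr0 mul0r in E0.
by rewrite E1 E0 -lastE; exact: loop1.
Qed.

Lemma continuous_circuit : continuous circuit.
Proof.
have cc : continuous (concat (fun l => loop (nth_strand l)) n).
  by apply: continuous_concat => l; exact: continuous_loop.
move=> x; exact: (@continuous_comp _ _ _ (fun w : R => n%:R * w) _ x
  (@mulrl_continuous _ _ _) (cc _)).
Qed.

Lemma curve_shift (z : int) t : curve (z%:~R + t) = curve t.
Proof.
rewrite /curve floorDzr ?intr_int//; congr circuit.
by rewrite intrKfloor intrD opprD addrACA subrr add0r.
Qed.

Lemma curve_circuit t : 0 <= t <= 1 -> curve t = circuit t.
Proof.
move=> /andP[t0]; rewrite le_eqVlt => /orP[/eqP ->|t1].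
  by rewrite /curve floor1 subrr circuit01.
by rewrite /curve (@floor_def _ t 0) ?subr0// t0.
Qed.

Lemma curveE l w : (l < n)%N -> 0 <= w <= 1 ->
  curve ((l%:R + w) / n%:R) = loop (nth_strand l) w.
Proof.
move=> ln w01; have /andP[w0 w1] := w01.
have ln' : l%:R + 1 <= n%:R :> R by rewrite natr1 ler_nat.
have t01 : 0 <= (l%:R + w) / n%:R <= 1.
  by rewrite divr_ge0 ?addr_ge0//= ler_pdivrMr// mul1r; lra.
by rewrite (curve_circuit t01); exact: circuitE.
Qed.

Lemma locate01 (t : R) : 0 <= t < 1 -> exists l w,
  [/\ (l < n)%N, 0 <= w < (1 : R) & t = (l%:R + w) / n%:R].
Proof.
move=> /andP[t0 t1]; have [|l [w [ln w01 tE]]] := @step_of R n (n%:R * t).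
  by rewrite mulr_ge0//= gtr_pMr.
have nn0 : n%:R != 0 :> R by rewrite gt_eqF.
by exists l, w; split => //; rewrite -tE mulrC mulKf.
Qed.

Lemma locate (t : R) : exists l w,
  [/\ (l < n)%N, 0 <= w < (1 : R) & t = (Num.floor t)%:~R + (l%:R + w) / n%:R].
Proof.
have [|l [w [ln w01 tE]]] := @locate01 (t - (Num.floor t)%:~R).
  rewrite subr_ge0 floor_le/= ltrBlDl.
  by have := floorD1_gt t; rewrite intrD.
by exists l, w; split => //; rewrite -tE addrC subrK.
Qed.

Lemma periodic_curve : periodic curve 1.
Proof. by move=> t; rewrite addrC; exact: (curve_shift 1 t). Qed.

Lemma continuous_curve : continuous curve.
Proof.
move=> t; set k := Num.floor t.
(* Since [circuit] is constant outside [0, 1] with equal end values, on each side of [k] one of the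
   first two terms equals [circuit 0]. Thus [F] is a formula for the curve on both sides of the
   integer [k], where the floor jumps. *)
pose F x := circuit (x - k%:~R) + circuit (x - (k - 1)%:~R) - circuit 0.
have Fc : F x @[x --> t] --> F t.
  apply: cvgB; last exact: cvg_cst.
  apply: cvgD.
    have c : x - k%:~R @[x --> t] --> t - k%:~R.
      by apply: cvgB; [exact: cvg_id|exact: cvg_cst].
    exact: (@continuous_cvg _ _ _ _ _ _ circuit _ (@continuous_circuit _) c).
  have c : x - (k - 1)%:~R @[x --> t] --> t - (k - 1)%:~R.
    by apply: cvgB; [exact: cvg_id|exact: cvg_cst].
  exact: (@continuous_cvg _ _ _ _ _ _ circuit _ (@continuous_circuit _) c).
have FE x : k%:~R - 1 < x -> x < k%:~R + 1 -> F x = curve x.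
  move=> kx xk; rewrite /F /curve intrB; have [xk'|xk'] := leP k%:~R x.
    rewrite (@floor_def _ x k) ?intrD ?xk' ?xk//.
    rewrite -[circuit (x - (_ - _))]circuit_clamped clamp_ge1 ?circuit01 ?addrK//; lra.
  rewrite (@floor_def _ x (k - 1)) ?subrK ?xk' ?andbT ?intrB ?ltW//.
  rewrite -[circuit (x - k%:~R)]circuit_clamped clamp_le0; last lra.
  by rewrite [circuit 0 + _]addrC addrK.
have tk : k%:~R <= t by exact: floor_le.
have kt : t < k%:~R + 1 by have := floorD1_gt t; rewrite intrD.
have Et : F t = curve t by apply: FE; lra.
rewrite Et in Fc.
apply: cvg_trans Fc; apply: near_eq_cvg; near=> x; apply: FE; near: x.
  by apply: lt_nbhsr; lra.
exact: lt_nbhsl.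
Unshelve. all: by end_near. Qed.

Lemma curve_inj : {in `[0, 1[ &, injective curve}.
Proof.
move=> s t; rewrite !in_itv/= => /locate01[l [w [ln w01 ->]]].
move=> /locate01[l' [w' [ln' w01' ->]]].
have le1 (x : R) : 0 <= x < 1 -> 0 <= x <= 1 by move=> /andP[-> /ltW].
rewrite (curveE ln (le1 _ w01)) (curveE ln' (le1 _ w01')).
move=> /(loop_inj B w01 w01')[ll' ->].
by rewrite (nth_strand_inj ln ln' ll').
Qed.

Lemma simple_closed_curve_curve : simple_closed_curve curve.
Proof. by split; [exact: continuous_curve|exact: periodic_curve|exact: curve_inj]. Qed.

Lemma range_curve : range curve = link M sigma V.
Proof.
apply/seteqP; split=> p.
  move=> [t _ <-]; have [l [w [ln /andP[w0 w1] ->]]] := locate t.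
  rewrite curve_shift curveE ?w0 ?ltW//; exists (nth_strand l) => //.
  by exists w => //=; rewrite in_itv/= w0 ltW.
move=> [i _ [w /= w01 <-]]; rewrite in_itv/= in w01.
by have [l ln <-] := nth_strand_surj i; exists ((l%:R + w) / n%:R) => //; rewrite curveE.
Qed.

End Curve.

Opaque curve.

(** * Crossings and dancers *)

Section Derivative.
Context {R : realType}.

Lemma near_affine_derive (f : R -> R) (t a b : R) :
  (\forall x \near t, f x = a + (x - t) * b) -> derivable f t 1 /\ derive1 f t = b.
Proof.
move=> fE; have gd : is_derive t 1 (fun x => a + (x - t) * b) b.
  have -> : (fun x => a + (x - t) * b) = (fun x => b * x + (a - t * b)).
    by apply/funext => x; ring.
  by apply: is_derive_eq; rewrite addr0 -[RHS]mulr1; congr (_ * _).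
have fd : is_derive t 1 f b.
  by apply: near_eq_is_derive gd; apply: filterS fE => x ->.
by split; [exact: ex_derive|rewrite derive1E; exact: derive_val].
Qed.

End Derivative.

(** * Double points of the diagram *)

Section Crossings.
Context {R : realType} (n M : nat) (sigma : 'S_n) (V : 'I_n -> nat -> R * R).
Context (B : pl_braid M sigma V).
Context (orb : forall i j, j \in fingraph.orbit sigma i).

Let curve := curve B.
Let strand_at := nth_strand B.

Definition slope i m : R := (V i m.+1).1 - (V i m).1.
Definition xline i m u : R := (V i m).1 + u * slope i m.

(** Two affine functions that differ at both ends of the step can only meet inside it, and parallel
    ones do not meet at all. *)
Lemma xline_eq i j m u : (m < M)%N -> i != j -> 0 <= u <= 1 ->
  xline i m u = xline j m u -> 0 < u < 1 /\ slope i m != slope j m.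
Proof.
move=> mM ij /andP[u0 u1] E; have sl : slope i m != slope j m.
  apply/negP => /eqP sE; move: E; rewrite /xline sE => /addIr /eqP.
  exact/negP/(pl_distinct B (ltnW mM) ij).
split=> //; apply/andP; split.
- rewrite lt_def u0 andbT; apply/negP => /eqP uE; move: E; rewrite /xline uE !mul0r !addr0.
  by move=> /eqP; exact/negP/(pl_distinct B (ltnW mM) ij).
- rewrite lt_def u1 andbT; apply/negP => /eqP uE; move: E; rewrite /xline -uE !mul1r.
  rewrite /slope ![_ + (_ - _)]addrC !subrK.
  by move=> /eqP; exact/negP/(pl_distinct B mM ij).
Qed.

Lemma xline_triple i j k m u : (m < M)%N -> 0 <= u <= 1 ->
  xline i m u = xline j m u -> xline j m u = xline k m u ->
  [\/ i = j, j = k | i = k].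
Proof.
move=> mM u01 ij jk; have [h hP] := pl_one_move B mM.
have still a b : a != h -> b != h -> xline a m u = xline b m u -> a = b.
  move=> ah bh; rewrite /xline /slope !hP// !subrr !mulr0 !addr0 => E.
  apply/eqP/negPn/negP => ab; move/eqP: E.
  exact/negP/(pl_distinct B (ltnW mM) ab).
have [ih|ih] := eqVneq i h; have [jh|jh] := eqVneq j h; have [kh|kh] := eqVneq k h.
- by apply: Or31; rewrite ih jh.
- by apply: Or31; rewrite ih jh.
- by apply: Or33; rewrite ih kh.
- by apply: Or32; exact: still.
- by apply: Or32; rewrite jh kh.
- by apply: Or33; apply: still => //; rewrite ij.
- by apply: Or31; exact: still.
- by apply: Or31; exact: still.
Qed.

Let n_gt0 : 0 < n%:R :> R. Proof. by rewrite ltr0n; exact: pl_strands_gt0 B. Qed.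
Let M_gt0 : 0 < M%:R :> R. Proof. by rewrite ltr0n; exact: pl_steps_gt0 B. Qed.

(** The factor 2 is due to the strand filling only the first half of its loop. *)
Definition step_time m u : R := (m%:R + u) / (2 * M%:R).

Lemma step_timeP w : 0 <= w <= 2^-1 ->
  exists m u, [/\ (m < M)%N, 0 <= u <= 1 & w = step_time m u].
Proof.
move=> /andP[w0 w1].
have [||m [u [mM u01 E]]] := @step_of_closed R M (M%:R * (2 * w)).
- exact: pl_steps_gt0 B.
- by rewrite mulr_ge0 ?mulr_ge0//= ler_piMr//; lra.
by exists m, u; split => //; rewrite /step_time -E; field; rewrite gt_eqF.
Qed.

Lemma step_time01 m u : (m < M)%N -> 0 <= u <= 1 -> 0 <= step_time m u <= 2^-1.
Proof.
move=> mM /andP[u0 u1]; have mM' : m%:R + 1 <= M%:R :> R by rewrite natr1 ler_nat.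
rewrite divr_ge0 ?addr_ge0 ?mulr_ge0//= ler_pdivrMr ?mulr_gt0//.
by rewrite mulrA mulVf ?mul1r ?pnatr_eq0//; lra.
Qed.

Lemma plane_loop i m u : (m < M)%N -> 0 <= u <= 1 ->
  plane_proj (loop M sigma V i (step_time m u)) = (xline i m u, 1 - (m%:R + u) / M%:R).
Proof.
move=> mM u01; have /andP[u0 u1] := u01.
have mM' : m%:R + 1 <= M%:R :> R by rewrite natr1 ler_nat.
rewrite (loop_strand B i (step_time01 mM u01)).
have -> : 2%:R * step_time m u = (m%:R + u) / M%:R.
  by rewrite /step_time; field; rewrite gt_eqF.
rewrite /strand pl_strandE// /lift /plane_proj /pt /=; congr (_, 1 - _).
by rewrite clamp_id// divr_ge0 ?addr_ge0//= ler_pdivrMr// mul1r; lra.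
Qed.

Lemma curve_double s t : plane_proj (curve s) = plane_proj (curve t) ->
  curve s = curve t \/
  exists l l' m u, [/\ [/\ (l < n)%N, (l' < n)%N, (m < M)%N & 0 <= u <= 1],
    strand_at l != strand_at l', xline (strand_at l) m u = xline (strand_at l') m u,
    s = (Num.floor s)%:~R + (l%:R + step_time m u) / n%:R
  & t = (Num.floor t)%:~R + (l'%:R + step_time m u) / n%:R].
Proof.
have le1 (x : R) : 0 <= x < 1 -> 0 <= x <= 1 by move=> /andP[-> /ltW].
have [l [w [ln w01 sE]]] := locate B s; have [l' [w' [ln' w01' tE]]] := locate B t.
have cs : curve s = loop M sigma V (strand_at l) w.
  by rewrite sE /curve curve_shift; exact: (@curveE _ _ _ _ _ B orb _ _ ln (le1 _ w01)).
have ct : curve t = loop M sigma V (strand_at l') w'.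
  by rewrite tE /curve curve_shift; exact: (@curveE _ _ _ _ _ B orb _ _ ln' (le1 _ w01')).
rewrite cs ct => E; have [ww [ij|[ij wl]]] := loop_proj_eq B w01 w01' E.
  by left; exact: (congr2 (loop M sigma V) ij ww).
right; have /andP[w0 _] := w01.
have [|m [u [mM u01 wE]]] := @step_timeP w; first by rewrite w0.
have E' : plane_proj (loop M sigma V (strand_at l) (step_time m u)) =
    plane_proj (loop M sigma V (strand_at l') (step_time m u)).
  by rewrite -wE; rewrite -ww in E; exact: E.
exists l, l', m, u; split; [by split|exact: ij| | |].
- have := etrans (esym (plane_loop _ mM u01)) (etrans E' (plane_loop _ mM u01)).
  by move=> /(congr1 fst).
- by rewrite -wE.
- by rewrite -wE ww.
Qed.

Lemma crossing_double s t : crossing curve s t ->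
  exists l l' m u, [/\ [/\ (l < n)%N, (l' < n)%N, (m < M)%N & 0 <= u <= 1],
    strand_at l != strand_at l', xline (strand_at l) m u = xline (strand_at l') m u,
    s = (Num.floor s)%:~R + (l%:R + step_time m u) / n%:R
  & t = (Num.floor t)%:~R + (l'%:R + step_time m u) / n%:R].
Proof. by move=> [/curve_double [->|//]]; rewrite ltxx. Qed.

Lemma finite_crossings : finite_set [set st : R * R |
  [/\ st.1 \in `[0, 1[, st.2 \in `[0, 1[ & crossing curve st.1 st.2]].
Proof.
pose f (x : 'I_n * 'I_n * 'I_M) : R * R :=
  let: (l, l', m) := x in
  let i := strand_at l in let j := strand_at l' in
  (* The only possible crossing time of strands [i] and [j] in step [m]. If the slopes agree the
     value is junk, which is harmless because only an inclusion in the image of [f] is claimed. *)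
  let u := ((V j m).1 - (V i m).1) / (slope i m - slope j m) in
  ((l%:R + step_time m u) / n%:R, (l'%:R + step_time m u) / n%:R).
apply: (@sub_finite_set _ _ (f @` setT)); last first.
  by apply: finite_image; exact: finite_finset.
move=> [s t] /= [s01 t01] /crossing_double[l [l' [m [u [[ln ln' mM u01] ij E sE tE]]]]].
have fl (x : R) : x \in `[0, 1[ -> Num.floor x = 0.
  by rewrite in_itv/= => x01; apply: floor_def; rewrite add0r.
have [_ sl] := xline_eq mM ij u01 E.
have d0 : slope (strand_at l) m - slope (strand_at l') m != 0 by rewrite subr_eq0.
have uE : ((V (strand_at l') m).1 - (V (strand_at l) m).1) /
    (slope (strand_at l) m - slope (strand_at l') m) = u.
  by apply: (mulIf d0); rewrite divfK//; move: E; rewrite /xline; lra.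
exists (Ordinal ln, Ordinal ln', Ordinal mM); first by [].
by rewrite /f /= uE sE tE !fl// !add0r.
Qed.

Lemma curve_near_affine l m u s (z : int) : (l < n)%N -> (m < M)%N -> 0 < u < 1 ->
  s = z%:~R + (l%:R + step_time m u) / n%:R ->
  \forall x \near s, plane_proj (curve x) =
    (xline (strand_at l) m u + (x - s) * (2 * n%:R * M%:R * slope (strand_at l) m),
     1 - (m%:R + u) / M%:R + (x - s) * (- (2 * n%:R))).
Proof.
(* [k] is the speed of the step parameter along the curve: [n] loops, each with [M] steps in its
   first half. *)
move=> ln mM /andP[u0 u1] sE; pose k := 2 * n%:R * M%:R : R.
have k0 : 0 < k by rewrite !mulr_gt0.
have E x : 0 < u + (x - s) * k -> u + (x - s) * k < 1 -> plane_proj (curve x) =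
    (xline (strand_at l) m u + (x - s) * (k * slope (strand_at l) m),
     1 - (m%:R + u) / M%:R + (x - s) * (- (2 * n%:R))).
  move=> v0 v1; have v01 : 0 <= u + (x - s) * k <= 1 by rewrite !ltW.
  have xE : x = z%:~R + (l%:R + step_time m (u + (x - s) * k)) / n%:R.
    have {1}-> : x = s + (x - s) by rewrite addrC subrK.
    by rewrite {1}sE /step_time /k; field; rewrite !gt_eqF.
  have /andP[w0 w1] := step_time01 mM v01.
  have w01 : 0 <= step_time m (u + (x - s) * k) <= 1 by rewrite w0 (le_trans w1)//; lra.
  rewrite [in LHS]xE /curve curve_shift (@curveE _ _ _ _ _ B orb _ _ ln w01).
  rewrite (plane_loop _ mM v01).
  congr (_, _); first by rewrite /xline mulrDl addrA -mulrA.
  by rewrite /k; field; rewrite gt_eqF.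
have kn0 : k != 0 by rewrite gt_eqF.
have s1 : s - u / k < s by rewrite ltrBlDr ltrDl divr_gt0.
have s2 : s < s + (1 - u) / k by rewrite ltrDl divr_gt0// subr_gt0.
near=> x; apply: E.
  have xs : s - u / k < x by near: x; exact: lt_nbhsr.
  have : 0 < (x - (s - u / k)) * k by rewrite mulr_gt0// subr_gt0.
  by rewrite opprB addrA mulrBl mulrDl divfK// addrC; lra.
have xs : x < s + (1 - u) / k by near: x; exact: lt_nbhsl.
have : 0 < (s + (1 - u) / k - x) * k by rewrite mulr_gt0// subr_gt0.
by rewrite mulrBl mulrDl divfK//; lra.
Unshelve. all: by end_near. Qed.

End Crossings.

(** * Inverting a clock *)

Section Clock.
Context {R : realType}.

Lemma contraction_inverse (g : R -> R) :
  (forall x y, `|g x - g y| <= 2^-1 * `|x - y|) ->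
  exists h : R -> R, [/\ forall a, h a + g (h a) = a, forall w, h (w + g w) = w,
    continuous h & {homo h : a b / a <= b}].
Proof.
move=> g_lip; have /choice[h hE] := contraction_surj g_lip.
have expand x y : `|x - y| <= 2 * `|(x + g x) - (y + g y)|.
  have -> : (x + g x) - (y + g y) = (x - y) + (g x - g y) by ring.
  have := ler_normB ((x - y) + (g x - g y)) (g x - g y).
  by rewrite addrK; have := g_lip x y; lra.
exists h; split => //.
- move=> w; apply/eqP; rewrite -subr_eq0 -normr_eq0 eq_le normr_ge0 andbT.
  by apply: (le_trans (expand _ _)); rewrite hE subrr normr0 mulr0.
- apply: (@lip_continuous _ R^o R^o 2) => a b.
  by apply: (le_trans (expand _ _)); rewrite !hE.
- move=> a b ab; rewrite leNgt; apply/negP => ba.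
  have := g_lip (h a) (h b); rewrite [X in _ <= _ * X]gtr0_norm ?subr_gt0// ler_norml.
  by move=> /andP[? ?]; have := hE a; have := hE b; lra.
Qed.

End Clock.

(** * The diagram and its dance *)

Section Dance.
Context {R : realType} (n M : nat) (sigma : 'S_n) (V : 'I_n -> nat -> R * R).
Context (B : pl_braid M sigma V).
Context (orb : forall i j, j \in fingraph.orbit sigma i).

Let curve := curve B.
Let strand_at := nth_strand B.
Let loop := loop M sigma V.

Let n_gt0 : 0 < n%:R :> R. Proof. by rewrite ltr0n; exact: pl_strands_gt0 B. Qed.
Let M_gt0 : 0 < M%:R :> R. Proof. by rewrite ltr0n; exact: pl_steps_gt0 B. Qed.

Lemma transverse_curve s t : crossing curve s t -> transverse curve s t.
Proof.
move=> /(crossing_double orb)[l [l' [m [u [[ln ln' mM u01] ij E sE tE]]]]].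
have [u01' sl] := xline_eq B mM ij u01 E.
have As := curve_near_affine B orb ln mM u01' sE.
have At := curve_near_affine B orb ln' mM u01' tE.
have [sx sx'] : derivable (fun x => (plane_proj (curve x)).1) s 1 /\
    derive1 (fun x => (plane_proj (curve x)).1) s =
      2 * n%:R * M%:R * slope V (strand_at l) m.
  by apply: near_affine_derive; apply: filterS As => x ->.
have [sy sy'] : derivable (fun x => (plane_proj (curve x)).2) s 1 /\
    derive1 (fun x => (plane_proj (curve x)).2) s = - (2 * n%:R).
  by apply: near_affine_derive; apply: filterS As => x ->.
have [tx tx'] : derivable (fun x => (plane_proj (curve x)).1) t 1 /\
    derive1 (fun x => (plane_proj (curve x)).1) t =
      2 * n%:R * M%:R * slope V (strand_at l') m.
  by apply: near_affine_derive; apply: filterS At => x ->.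
have [ty ty'] : derivable (fun x => (plane_proj (curve x)).2) t 1 /\
    derive1 (fun x => (plane_proj (curve x)).2) t = - (2 * n%:R).
  by apply: near_affine_derive; apply: filterS At => x ->.
split; [exact: (conj sx sy)|exact: (conj tx ty)|].
rewrite sx' sy' tx' ty'.
(* Both strands descend at the same speed, so the determinant is a nonzero multiple of the
   difference of the slopes. *)
rewrite (_ : _ - _ = - (2 * n%:R) * (2 * n%:R * M%:R) *
  (slope V (strand_at l) m - slope V (strand_at l') m)); last by ring.
have n2 : 2 * n%:R != 0 :> R by rewrite gt_eqF// mulr_gt0.
have M0 : M%:R != 0 :> R by rewrite gt_eqF.
by apply: mulf_neq0; [rewrite mulf_neq0 ?oppr_eq0// mulf_neq0|rewrite subr_eq0].
Qed.

Lemma no_triple_point (r s t : R) :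
  r \in `[0, 1[ -> s \in `[0, 1[ -> t \in `[0, 1[ ->
  plane_proj (curve r) = plane_proj (curve s) ->
  plane_proj (curve s) = plane_proj (curve t) -> [\/ r = s, s = t | r = t].
Proof.
have le1 (x : R) : 0 <= x < 1 -> 0 <= x <= 1 by move=> /andP[-> /ltW].
rewrite !in_itv/= => /(locate01 B)[l1 [w1 [ln1 w01 ->]]].
move=> /(locate01 B)[l2 [w2 [ln2 w02 ->]]] /(locate01 B)[l3 [w3 [ln3 w03 ->]]].
rewrite /curve (@curveE _ _ _ _ _ B orb _ _ ln1 (le1 _ w01)).
rewrite (@curveE _ _ _ _ _ B orb _ _ ln2 (le1 _ w02)).
rewrite (@curveE _ _ _ _ _ B orb _ _ ln3 (le1 _ w03)) => E12 E23.
have [w12 H12] := loop_proj_eq B w01 w02 E12.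
have [w23 H23] := loop_proj_eq B w02 w03 E23.
case: H12 => [/(nth_strand_inj orb ln1 ln2) ->|[_ wl]].
  by apply: Or31; rewrite w12.
case: H23 => [/(nth_strand_inj orb ln2 ln3) ->|[_ _]].
  by apply: Or32; rewrite w23.
have /andP[w0 _] := w01.
have [|m [u [mM u01 wE]]] := step_timeP B (w := w1); first by rewrite w0.
rewrite -w23 -w12 wE in E12 E23.
have := etrans (esym (plane_loop B _ mM u01)) (etrans E12 (plane_loop B _ mM u01)).
move=> /(congr1 fst) /= x12.
have := etrans (esym (plane_loop B _ mM u01)) (etrans E23 (plane_loop B _ mM u01)).
move=> /(congr1 fst) /= x23.
case: (xline_triple B mM u01 x12 x23).
- by move=> /(nth_strand_inj orb ln1 ln2) ->; apply: Or31; rewrite w12.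
- by move=> /(nth_strand_inj orb ln2 ln3) ->; apply: Or32; rewrite w23.
- by move=> /(nth_strand_inj orb ln1 ln3) ->; apply: Or33; rewrite w12 w23.
Qed.

(** The conclusion [0 < w] says that no crossing lies at the start of a loop. It keeps the initial
    points off the crossings and settles the parameter 1, where a loop meets the start of the
    next. *)
Lemma loop_crossing_halfopen i j w w' : 0 <= w < 1 -> 0 <= w' < 1 ->
  plane_proj (loop i w) = plane_proj (loop j w') ->
  depth (loop i w) < depth (loop j w') -> w = w' /\ 0 < w.
Proof.
move=> w01 w01' E; have [ww [ij|[ij wl]]] := loop_proj_eq B w01 w01' E.
  by rewrite ij ww ltxx.
move=> _; split; first exact: ww.
have /andP[w0 _] := w01.
have [|m [u [mM u01 wE]]] := step_timeP B (w := w); first by rewrite w0.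
rewrite -ww wE in E.
have := etrans (esym (plane_loop B _ mM u01)) (etrans E (plane_loop B _ mM u01)).
move=> /(congr1 fst) /= xE; have [/andP[u0 _] _] := xline_eq B mM ij u01 xE.
by rewrite wE divr_gt0 ?mulr_gt0 ?ltr_wpDl.
Qed.

(** The closed interval is needed because a dancer at the final time stands on the initial point of
    the next one. *)
Lemma loop_crossing i j w w' : 0 <= w <= 1 -> 0 <= w' <= 1 ->
  plane_proj (loop i w) = plane_proj (loop j w') ->
  depth (loop i w) < depth (loop j w') -> w = w'.
Proof.
have z01 : 0 <= (0 : R) < 1 by rewrite lexx ltr01.
have l1 k : loop k 1 = loop (sigma k) 0 by exact: loop1.
move=> /andP[w0]; rewrite le_eqVlt => /orP[/eqP ->|w1];
  move=> /andP[w0']; rewrite le_eqVlt => /orP[/eqP ->|w1'].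
- by [].
- rewrite l1 => E D; have w01' : 0 <= w' < 1 by rewrite w0'.
  by have [_] := loop_crossing_halfopen z01 w01' E D; rewrite ltxx.
- rewrite l1 => E D; have w01 : 0 <= w < 1 by rewrite w0.
  by have [->] := loop_crossing_halfopen w01 z01 E D; rewrite ltxx.
- have w01 : 0 <= w < 1 by rewrite w0.
  have w01' : 0 <= w' < 1 by rewrite w0'.
  by move=> E D; have [] := loop_crossing_halfopen w01 w01' E D.
Qed.

(** Closing arcs and both ends of a strand have depth 0, so the clamped strand gives the depth along
    the whole loop, and its Lipschitz bound carries over. *)
Lemma depth_loop i w : depth (loop i w) = (pl_strand M V i (2 * w)).2.
Proof.
have c0 : w <= 0 -> clamp (2 * w) = 0 by move=> ?; apply: clamp_le0; lra.
have c1 : 2^-1 < w -> clamp (2 * w) = 1 by move=> ?; apply: clamp_ge1; lra.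
have p0 : (pl_strand M V i 0).2 = 0.
  exact: (congr1 (@depth R) (strand0 B i)).
have p1 : (pl_strand M V i 1).2 = 0.
  exact: (congr1 (@depth R) (etrans (strand1 B i) (arc0 _))).
have [w0|w0] := leP w 0.
  by rewrite /loop -loop_clamped -pl_strand_clamped (clamp_le0 w0) (c0 w0) (loop0 B) p0.
have [w1|w1] := leP w 2^-1.
  have w01 : 0 <= w <= 2^-1 by rewrite ltW.
  by rewrite /loop (loop_strand B i w01).
rewrite -pl_strand_clamped (c1 w1) p1; have [w2|w2] := leP w 1.
  have w01 : 2^-1 <= w <= 1 by rewrite ltW.
  by rewrite /loop (loop_arc B i w01).
by rewrite /loop -loop_clamped (clamp_ge1 (ltW w2)) (loop1 B) (loop0 B).
Qed.

(** A dancer reaches loop parameter [w] at time [w + e * depth], and [h i] inverts this. The times 0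
    and 1 are fixed because the depth vanishes at both ends of a loop, so all dancers start and
    finish together. *)
Lemma clocks : exists (e : R) (h : 'I_n -> R -> R),
  0 < e /\ forall i,
    [/\ forall a, h i a + e * depth (loop i (h i a)) = a, continuous (h i),
        {homo h i : a b / a <= b}, h i 0 = 0 & h i 1 = 1].
Proof.
have [e e0 eP] : exists2 e, 0 < e & forall i w w',
    `|e * depth (loop i w) - e * depth (loop i w')| <= 2^-1 * `|w - w'|.
  apply: (@finite_pos _ _ (fun i e => forall w w',
    `|e * depth (loop i w) - e * depth (loop i w')| <= 2^-1 * `|w - w'|)).
    move=> i x y /andP[y0 yx] H w w'; apply: le_trans (H w w').
    rewrite -!mulrBr !normrM (gtr0_norm y0) (gtr0_norm (lt_le_trans y0 yx)).
    by rewrite ler_wpM2r.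
  move=> i; have [L LP] := pl_strand_lip M V i.
  (* One factor 2 compensates the doubled speed in [depth_loop], the other gives the constant 1/2;
     adding 1 keeps the denominator positive. *)
  have L0 : 0 < 4 * (`|L| + 1) by have := normr_ge0 L; lra.
  exists (4 * (`|L| + 1))^-1; first by rewrite invr_gt0.
  move=> w w'; rewrite -mulrBr normrM gtr0_norm ?invr_gt0// ler_pdivrMl// !depth_loop.
  have /le_trans -> // :
      `|(pl_strand M V i (2 * w)).2 - (pl_strand M V i (2 * w')).2| <=
      L * `|2 * w - 2 * w'|.
    by apply: le_trans (LP _ _); rewrite prod_normE le_max lexx orbT.
  rewrite -mulrBr normrM (ger0_norm (ler0n _ 2)).
  have := ler_norm L; have := normr_ge0 (w - w'); nra.
have /choice[h hP] := fun i => contraction_inverse (eP i).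
exists e, h; split=> // i; have [h1 h2 h3 h4] := hP i; split => //.
- have := h2 0; rewrite depth_loop mulr0 -[(pl_strand _ _ _ _).2]/(depth (strand M V i 0)).
  by rewrite (strand0 B) mulr0 addr0.
- have := h2 1; rewrite /loop (loop1 B) (loop0 B).
  by rewrite [depth _]/= mulr0 addr0.
Qed.

Lemma many_danceable_curve : many_danceable n curve.
Proof.
have [e [h [e0 hP]]] := clocks.
have nn0 : n%:R != 0 :> R by rewrite gt_eqF.
have h01 i a : a \in `[0, 1] -> 0 <= h i a <= 1.
  rewrite in_itv/= => /andP[a0 a1]; have [_ _ hm h0 h1] := hP i.
  by apply/andP; split; [rewrite -[leLHS]h0|rewrite -[leRHS]h1]; exact: hm.
have start i t : (i < n)%N -> plane_proj (curve (i%:R / n%:R)) = plane_proj (curve t) ->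
    depth (curve (i%:R / n%:R)) != depth (curve t) -> False.
  move=> ln; have z01 : 0 <= (0 : R) < 1 by rewrite lexx ltr01.
  have z01' : 0 <= (0 : R) <= 1 by rewrite lexx ler01.
  have [l [w [lnl w01 tE]]] := locate B t.
  have w01' : 0 <= w <= 1 by move: w01 => /andP[-> /ltW].
  have ci : curve (i%:R / n%:R) = loop (strand_at i) 0.
    by have := @curveE _ _ _ _ _ B orb _ _ ln z01'; rewrite addr0.
  have ct : curve t = loop (strand_at l) w.
    by rewrite tE /curve curve_shift; exact: (@curveE _ _ _ _ _ B orb _ _ lnl w01').
  rewrite ci ct => E; rewrite neq_lt => /orP[D|D].
    by have [_] := loop_crossing_halfopen z01 w01 E D; rewrite ltxx.
  by have [->] := loop_crossing_halfopen w01 z01 (esym E) D; rewrite ltxx.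
exists (fun l => l%:R / n%:R), 1, (fun l a => (l%:R + h (strand_at l) a) / n%:R); split.
- split=> [|i _]; first by rewrite divff// mul0r add0r.
  by rewrite ltr_pM2r ?invr_gt0// ltr_nat.
- move=> i t ln; split=> -[E D]; apply: (start i t ln) => //; first by rewrite lt_eqF.
  by rewrite gt_eqF.
- exact: ltr01.
- move=> i _; have [_ hc hm h0 h1] := hP (strand_at i); split.
  + apply: continuous_subspaceT => a; apply: cvgM; last exact: cvg_cst.
    by apply: cvgD; [exact: cvg_cst|exact: hc].
  + move=> a b _ _ ab; rewrite ler_pM2r ?invr_gt0// lerD2l; exact: hm.
  + by rewrite h0 addr0.
  + by rewrite h1 natr1.
move=> i j a b ln ln' a01 b01.
rewrite /crossing /curve (@curveE _ _ _ _ _ B orb _ _ ln (h01 _ _ a01)).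
rewrite (@curveE _ _ _ _ _ B orb _ _ ln' (h01 _ _ b01)) => -[E D].
have ww := loop_crossing (h01 _ _ a01) (h01 _ _ b01) E D.
have [ha _ _ _ _] := hP (strand_at i); have [hb _ _ _ _] := hP (strand_at j).
rewrite -(ha a) -(hb b) ww ltrD2l (ltr_pM2l e0).
by rewrite ww in D; exact: D.
Qed.

Lemma danceable_curve : danceable n curve.
Proof.
have [n1|n1] := leqP n 1; last by right; split=> //; exact: many_danceable_curve.
(* A crossing needs two distinct strands, so with a single strand there is none and any initial
   point will do. *)
left; split; first by apply/eqP; rewrite eqn_leq n1; exact: pl_strands_gt0 B.
exists 0 => s t _ _ /(crossing_double orb)[l [l' [m [u [_ /eqP ij _ _ _]]]]].
case: ij; apply/val_inj; move: (ltn_ord (nth_strand B l)) (ltn_ord (nth_strand B l')).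
by rewrite /=; lia.
Qed.

Lemma diagram_of_curve K : ambient_isotopic K (link M sigma V) -> diagram_of K curve.
Proof.
move=> Kl; split.
- exact: simple_closed_curve_curve.
- by rewrite /curve range_curve.
- exact: finite_crossings.
- exact: transverse_curve.
- exact: no_triple_point.
Qed.

End Dance.

(** * From the given closed braid to the danceable diagram *)

Section Main.
Context {R : realType}.
Implicit Types (K : set (space3 R)).

(** Loop [i] contains the closing arc of [sigma i], whereas [closure_of] pairs strand [i] with arc
    [i]; the union is reindexed by the permutation. *)
Lemma link_pieces n M (sigma : 'S_n) (V : 'I_n -> nat -> R * R) :
  pl_braid M sigma V ->
  link M sigma V = \bigcup_(i in setT)
    ((fun s => lift (pl_strand M V i s) (1 - s)) @` `[0, 1] `|` @closing_arc R i).
Proof.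
move=> B; apply/seteqP; split=> p.
  move=> [i _ [w /= w01 <-]]; move: w01; rewrite in_itv/= => /andP[w0 w1].
  have [wl|wl] := leP w 2^-1.
    exists i => //; left; exists (2 * w).
      by rewrite /= in_itv/=; apply/andP; split; lra.
    rewrite (loop_strand B) ?w0// /strand clamp_id//; apply/andP; split; lra.
  exists (sigma i) => //; right; rewrite -range_arc; exists (2 * w - 1).
    by rewrite /= in_itv/=; apply/andP; split; lra.
  by rewrite (loop_arc B) ?w1 ?ltW.
move=> [i _ [[s /= s01 <-]|]].
  exists i => //; exists (s / 2).
    by move: s01; rewrite /= !in_itv/= => /andP[? ?]; apply/andP; split; lra.
  rewrite in_itv/= in s01; have /andP[s0 s1] := s01.
  rewrite (loop_strand B); last by apply/andP; split; lra.
  have -> : 2%:R * (s / 2) = s by field.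
  by rewrite /strand clamp_id.
rewrite -range_arc => -[u u01 <-]; exists ((sigma^-1)%g i) => //.
rewrite /= in_itv/= in u01; have /andP[u0 u1] := u01.
exists ((u + 1) / 2); first by rewrite /= in_itv/=; apply/andP; split; lra.
rewrite (loop_arc B); last by apply/andP; split; lra.
by rewrite permKV (_ : 2%:R * ((u + 1) / 2) - 1 = u)//; field.
Qed.

Lemma pl_braid_approx n (beta : 'I_n -> R -> space3 R) : (0 < n)%N -> braid beta ->
  exists (M : nat) (sigma : 'S_n) (V : 'I_n -> nat -> R * R), pl_braid M sigma V /\
    forall K, ambient_isotopic K (closure_of beta) ->
      ambient_isotopic K (link M sigma V).
Proof.
move=> n0 /braid_strands[q [sigma [r [qc q01 [r0 qr] qsep qE]]]].
have n0' : 1 <= n%:R :> R by rewrite ler1n.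
(* Below the bound r / (2n) of [move_points]; being also at most r / 4, it keeps the new strands
   disjoint and in x > 0. *)
pose e := r / (4 * n%:R).
have e0 : 0 < e by rewrite divr_gt0// mulr_gt0//; lra.
have er : e <= r / 4.
  by rewrite /e invfM mulrA ler_piMr ?invf_le1 ?divr_ge0//; lra.
have [|||M [V [M0 VE Vx Vmove Vclose]]] := @pl_approx R n q sigma e n0 e0.
- by move=> i; have [] := qc i.
- by move=> i; have [] := q01 i.
- by move=> i; have [] := q01 i.
have close i s : `|pl_strand M V i s - q i s| <= e.
  have [_ qcl] := qc i; rewrite -pl_strand_clamped -(qcl s).
  by apply: Vclose; rewrite clamp_ge0 clamp_le1.
have B : pl_braid M sigma V.
  split => //.
  - by move=> i; have [-> _] := VE i; have [] := q01 i.
  - by move=> i; have [_ ->] := VE i; have [] := q01 i.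
  - move=> i s; have := close i s; rewrite prod_normE ge_max => /andP[+ _].
    by rewrite ler_norml /= => /andP[? _]; have := qr i s; lra.
  - move=> i j s ij E; have := qsep i j s ij; have := close i s; have := close j s.
    have := ler_distD (pl_strand M V i s) (q i s) (q j s).
    by rewrite [`|q i s - pl_strand _ _ _ _|]distrC [in X in _ <= _ + X]E; lra.
have [||||F [Fiso Fq Ffix]] := @move_points R n q (pl_strand M V) r n0 r0.
- by move=> i; have [] := qc i.
- by move=> i; exact: continuous_pl_strand.
- exact: qsep.
- move=> i s; apply: le_trans (close i s) _; rewrite /e.
  by rewrite ler_pM2l// lef_pV2 ?posrE ?mulr_gt0//; lra.
exists M, sigma, V; split=> // K Kb; apply: (ambient_isotopic_trans Kb).
suff -> : link M sigma V = F @` closure_of beta by exact: Fiso.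
(* At heights at least 1 or at most 0 the old and new strands both rest at a common end point, so
   nothing is displaced; where x <= 0 the arc is at distance at least [r] from all strands. *)
have Farc i p : @closing_arc R i p -> F p = p.
  rewrite -range_arc => -[u u01 <-]; rewrite /= in_itv/= in u01.
  have c1 : 1 <= i.+1%:R :> R by rewrite ler1n.
  have out := arc_outside c1 u01; apply: Ffix => j.
  have [_ qcl] := qc j; have [q0 q1] := q01 j.
  have b0 : pl_strand M V j 0 = q j 0.
    by rewrite q0; have := congr1 (@planar R) (strand0 B j); rewrite planar_lift.
  have b1 : pl_strand M V j 1 = q j 1.
    rewrite q1; have := congr1 (@planar R) (etrans (strand1 B j) (arc0 _)).
    by rewrite planar_lift.
  move: out; rewrite /plane_proj -/(height _) -/(xcoord _) => out.
  case: out => out; [right|right|left].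
  - have s0 : 1 - height (arc i.+1%:R u) <= 0 by lra.
    by rewrite -qcl -pl_strand_clamped (clamp_le0 s0).
  - have s1 : 1 <= 1 - height (arc i.+1%:R u) by lra.
    by rewrite -qcl -pl_strand_clamped (clamp_ge1 s1).
  - rewrite prod_normE le_max; apply/orP; left; rewrite distrC ger0_norm.
      by have := qr j (1 - height (arc i.+1%:R u)); rewrite /= -/(xcoord _); lra.
    by have := qr j (1 - height (arc i.+1%:R u)); rewrite /= -/(xcoord _); lra.
rewrite (link_pieces B) /closure_of; apply/seteqP; split=> p.
  move=> [i _ [[s s01 <-]|ip]].
    exists (lift (q i s) (1 - s)); last by rewrite Fq.
    by exists i => //; left; rewrite qE; exists s.
  by exists p; [exists i => //; right|exact: Farc ip].
move=> [x [i _ [+|ix]] <-].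
  by rewrite qE => -[s s01 <-]; exists i => //; left; exists s => //; rewrite Fq.
by rewrite (Farc _ _ ix); exists i => //; right.
Qed.

Lemma knot_isotopic_connected K L : knot K -> ambient_isotopic K L -> connected L.
Proof.
move=> [[g [gc _ _] ->] _] [H [_ Hh _ <-]].
have [|Hc _] := Hh 1; first by rewrite in_itv/= lexx ler01.
have cT : connected [set: R] by apply/connected_intervalP.
rewrite image_comp; apply: connected_continuous_connected cT _.
by apply: continuous_subspaceT => t; apply: continuous_comp; [exact: gc|exact: Hc].
Qed.

Lemma braid_closure_danceable n K (beta : 'I_n -> R -> space3 R) :
  knot K -> braid beta -> ambient_isotopic K (closure_of beta) ->
  exists2 gamma, diagram_of K gamma & danceable n gamma.
Proof.
(* The closure of the braid without strands is empty, and a knot is not. *)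
move=> hK hb Kb; have n0 : (0 < n)%N.
  have [[g _ KE] _] := hK; have [H [_ _ _ HK]] := Kb.
  have : closure_of beta (H 1 (g 0)) by rewrite -HK KE; exists (g 0) => //; exists 0.
  by move=> [i _ _]; exact: leq_ltn_trans (ltn_ord i).
have [M [sigma [V [B iso]]]] := pl_braid_approx n0 hb.
have orb := connected_link_orbit B (knot_isotopic_connected hK (iso _ Kb)).
exists (curve B); first exact: (diagram_of_curve B orb (iso _ Kb)).
exact: danceable_curve.
Qed.

End Main.

Theorem theorem3 (R : realType) (K : set (space3 R)) (hK : knot K) :
  (danceability K <= braid_index K)%E.
Proof.
apply: le_ereal_inf => _ [n [beta hb Kb] <-]; exists n => //.
exact: braid_closure_danceable hK hb Kb.
Qed.
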